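(* Let $\lambda$ be an infinite cardinal that is completely characterizable. Then $\lambda^{\aleph_0}$ is homogeneously characterizable.
   Context: All languages are countable; $L_{\omega_1,\omega}$ allows countable conjunctions/disjunctions and finite quantification. A sentence $\sigma\in L_{\omega_1,\omega}$ is complete if for every $L_{\omega_1,\omega}$-sentence $\tau$, either $\sigma\Rightarrow\tau$ or $\sigma\Rightarrow\neg\tau$ is valid. An infinite cardinal $\kappa$ is completely characterizable if there is a complete $L_{\omega_1,\omega}$-sentence with models in all infinite cardinalities $\le\kappa$ and no model of cardinality $\kappa^+$. A unary predicate $P$ is completely homogeneous for a structure $\mathcal A$ if $P^{\mathcal A}$ is infinite and every permutation of $P^{\mathcal A}$ extends to an automorphism of $\mathcal A$. The cardinal $\kappa$ is homogeneously characterizable if there are a complete $L_{\omega_1,\omega}$-sentence $\phi_\kappa$ and a unary predicate $P_\kappa$ in its language such that: $\phi_\kappa$ has no model of cardinality $>\kappa$; in the unique countable model $\mathcal M$ of $\phi_\kappa$, $P_\kappa$ is infinite and completely homogeneous for $\mathcal M$; and there is a model $\mathcal A$ of $\phi_\kappa$ with $|P_\kappa^{\mathcal A}|=\kappa$. *)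

(* Defs.v *)
From Stdlib Require Import Arith.

Definition injective {A B : Type} (f : A -> B) : Prop :=
  forall x y, f x = f y -> x = y.
Definition bijective {A B : Type} (f : A -> B) : Prop :=
  exists g : B -> A, (forall x, g (f x) = x) /\ (forall y, f (g y) = y).

Definition card_le (A B : Type) : Prop := exists f : A -> B, injective f.
Definition card_eq (A B : Type) : Prop := exists f : A -> B, bijective f.
Definition card_lt (A B : Type) : Prop := card_le A B /\ ~ card_le B A.
Definition infinite_type (A : Type) : Prop := card_le nat A.
Definition countable_type (A : Type) : Prop := card_le A nat.

Definition is_succ_card (K T : Type) : Prop :=
  card_lt K T /\ forall S : Type, card_lt K S -> card_le T S.

Record lang := Lang {
  fsym : Type;
  far : fsym -> nat;
  rsym : Type;
  rar : rsym -> nat;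
  fsym_countable : countable_type fsym;
  rsym_countable : countable_type rsym }.

Definition arg (n : nat) := { i : nat | i < n }.

Section Syntax.
Variable L : lang.

(** terms with de Bruijn variables *)
Inductive term : Type :=
| Var : nat -> term
| Fun : forall f : fsym L, (arg (far L f) -> term) -> term.

(** formulas of L_{omega_1,omega}: countable conjunction (finite conjunctions
    and all disjunctions are derived), negation, existential quantifier *)
Inductive formula : Type :=
| Eq : term -> term -> formula
| Rel : forall r : rsym L, (arg (rar L r) -> term) -> formula
| Neg : formula -> formula
| BigAnd : (nat -> formula) -> formula
| Ex : formula -> formula.

Fixpoint term_bound (k : nat) (t : term) : Prop :=
  match t with
  | Var n => n < k
  | Fun f ts => forall i, term_bound k (ts i)
  end.

Fixpoint fbound (k : nat) (phi : formula) : Prop :=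
  match phi with
  | Eq t u => term_bound k t /\ term_bound k u
  | Rel r ts => forall i, term_bound k (ts i)
  | Neg p => fbound k p
  | BigAnd ps => forall n, fbound k (ps n)
  | Ex p => fbound (S k) p
  end.

Definition sentence (phi : formula) : Prop := fbound 0 phi.

Definition Impl (p q : formula) : formula :=
  Neg (BigAnd (fun n => match n with 0 => p | _ => Neg q end)).
End Syntax.

Arguments Var {L}. Arguments Fun {L}. Arguments Eq {L}. Arguments Rel {L}.
Arguments Neg {L}. Arguments BigAnd {L}. Arguments Ex {L}.

Record structure (L : lang) := Structure {
  dom : Type;
  dom_inhabited : inhabited dom;
  ifun : forall f : fsym L, (arg (far L f) -> dom) -> dom;
  irel : forall r : rsym L, (arg (rar L r) -> dom) -> Prop }.

Arguments dom {L}. Arguments ifun {L}. Arguments irel {L}.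

Definition scons {A : Type} (a : A) (e : nat -> A) : nat -> A :=
  fun n => match n with 0 => a | S m => e m end.

Fixpoint eval {L} (M : structure L) (e : nat -> dom M) (t : term L) : dom M :=
  match t with
  | Var n => e n
  | Fun f ts => ifun M f (fun i => eval M e (ts i))
  end.

Fixpoint sat {L} (M : structure L) (e : nat -> dom M) (phi : formula L) : Prop :=
  match phi with
  | Eq t u => eval M e t = eval M e u
  | Rel r ts => irel M r (fun i => eval M e (ts i))
  | Neg p => ~ sat M e p
  | BigAnd ps => forall n, sat M e (ps n)
  | Ex p => exists a : dom M, sat M (scons a e) p
  end.

Definition models {L} (M : structure L) (sigma : formula L) : Prop :=
  forall e : nat -> dom M, sat M e sigma.

Definition valid {L} (phi : formula L) : Prop :=
  forall (M : structure L) (e : nat -> dom M), sat M e phi.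

Definition complete_sentence {L} (sigma : formula L) : Prop :=
  sentence L sigma /\
  forall tau : formula L, sentence L tau ->
    valid (Impl L sigma tau) \/ valid (Impl L sigma (Neg tau)).

Definition completely_characterizable (K : Type) : Prop :=
  infinite_type K /\
  exists (L : lang) (sigma : formula L),
    complete_sentence sigma /\
    (forall T : Type, infinite_type T -> card_le T K ->
       exists M : structure L, models M sigma /\ card_eq (dom M) T) /\
    (forall T : Type, is_succ_card K T ->
       ~ exists M : structure L, models M sigma /\ card_eq (dom M) T).

(** interpretation of a unary predicate symbol p (with rar p = 1) *)
Definition Pset {L} (M : structure L) (p : rsym L) (x : dom M) : Prop :=
  irel M p (fun _ => x).

Definition automorphism {L} (M : structure L) (g : dom M -> dom M) : Prop :=
  bijective g /\
  (forall f (xs : arg (far L f) -> dom M), g (ifun M f xs) = ifun M f (fun i => g (xs i))) /\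
  (forall r (xs : arg (rar L r) -> dom M), irel M r xs <-> irel M r (fun i => g (xs i))).

Definition completely_homogeneous {L} (p : rsym L) (M : structure L) : Prop :=
  infinite_type { x : dom M | Pset M p x } /\
  forall s : { x : dom M | Pset M p x } -> { x : dom M | Pset M p x },
    bijective s ->
    exists g : dom M -> dom M, automorphism M g /\
      forall x : { x : dom M | Pset M p x }, g (proj1_sig x) = proj1_sig (s x).

Definition homogeneously_characterizable (K : Type) : Prop :=
  infinite_type K /\
  exists (L : lang) (phi : formula L) (p : rsym L),
    rar L p = 1 /\
    complete_sentence phi /\
    (~ exists M : structure L, models M phi /\ card_lt K (dom M)) /\
    (exists M : structure L, models M phi /\ countable_type (dom M)) /\
    (forall M : structure L, models M phi -> countable_type (dom M) ->
       completely_homogeneous p M) /\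
    (exists A : structure L, models A phi /\
       card_eq { x : dom A | Pset A p x } K).

(* Main.v *)
From Stdlib Require Import List FinFun Arith Cantor Classical ClassicalEpsilon Lia.
From Stdlib Require Import FunctionalExtensionality PropExtensionality ProofIrrelevance.
From mathcomp.classical Require classical_sets boolp wochoice.
Require Import Defs.
Import ListNotations.

(** Let [sigma] characterize [K].  Consider a model [U] of [sigma], a set [V] of
    sequences of finite subsets of [U], and a colouring of [V] by a set [P] in which
    every colour is dense.  The entries of a sequence are not part of the structure:
    only the symmetric difference of two entries at the first place where the
    sequences may differ is.  Hence all nodes of the tree look alike, and
    automorphisms may act by an independent translation at each node; a back-and-forth
    argument, guided by the branch that splits last, extends any isomorphism between
    the [U] parts together with any bijection between the [P] parts to the sequences.
    So there is one countable model, and its [P] is completely homogeneous.  A model is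
    bounded by the number of branches, that is [nat -> K], because [U] is bounded by
    [K] (Löwenheim-Skolem and the absence of a model of size [K^+]).  The model of
    all sequences of finite subsets attains the bound, the colour of a sequence being
    read off its tail. *)

(** * Cardinal arithmetic *)

(** Hiding the entries is essential. If they were definable, an automorphism fixing [RU] pointwise
    would fix every sequence, hence every colour; when the countable model of [sigma] is rigid, no
    nontrivial permutation of [RP] could extend. Yet [RU] must still bound the branching at each
    node. Finite subsets reconcile the two: under symmetric difference they form a group, obtained
    from the bare set [RU] without using its structure and of the same size when [RU] is infinite,
    and this group acts simply transitively on the children of a node. So the children are counted
    by [RU] although none of them is distinguished. Density of the colours leaves the colour free
    after any finite initial segment has been fixed, so a position in the tree and a colour can be
    prescribed independently. *)

Lemma card_le_refl (A : Type) : card_le A A.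
Proof. exists (fun x => x). intros x y H. exact H. Qed.

Lemma card_le_trans (A B C : Type) : card_le A B -> card_le B C -> card_le A C.
Proof.
  intros [f Hf] [g Hg]. exists (fun x => g (f x)).
  intros x y H. apply Hf, Hg, H.
Qed.

Lemma card_le_of_surjection (A B : Type) (f : A -> B) :
  (forall b, exists a, f a = b) -> card_le B A.
Proof.
  intros H. destruct (choice _ H) as [g Hg]. exists g. intros x y E.
  rewrite <- (Hg x), E. apply Hg.
Qed.

Lemma surjection_of_card_le (A B : Type) :
  card_le A B -> inhabited A -> exists f : B -> A, forall a, exists b, f b = a.
Proof.
  intros [f Hf] [a0].
  assert (H : forall b, exists a, forall a', f a' = b -> a = a').
  { intros b. destruct (classic (exists a, f a = b)) as [[a Ha]|N].
    - exists a. intros a' Ha'. apply Hf. congruence.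
    - exists a0. intros a' Ha'. exfalso. eauto. }
  destruct (choice _ H) as [g Hg]. exists g. intros a. exists (f a). auto.
Qed.

Lemma card_le_sig (A : Type) (Q : A -> Prop) : card_le {x | Q x} A.
Proof.
  exists (@proj1_sig _ _). intros [x Hx] [y Hy] E. simpl in E. subst y.
  f_equal. apply proof_irrelevance.
Qed.

Lemma sig_eq (A : Type) (Q : A -> Prop) (x y : {a | Q a}) :
  proj1_sig x = proj1_sig y -> x = y.
Proof.
  destruct x as [x Hx], y as [y Hy]. simpl. intros ->. f_equal. apply proof_irrelevance.
Qed.

Lemma countable_nonempty_enum (A : Type) :
  countable_type A -> inhabited A -> exists f : nat -> A, forall a, exists n, f n = a.
Proof. apply surjection_of_card_le. Qed.

Lemma card_eq_le (A B : Type) : card_eq A B -> card_le A B.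
Proof.
  intros [f [g [H1 H2]]]. exists f. intros x y E.
  rewrite <- (H1 x), E. apply H1.
Qed.

Lemma card_eq_sym (A B : Type) : card_eq A B -> card_eq B A.
Proof. intros [f [g [H1 H2]]]. exists g, f. split; assumption. Qed.

Lemma bijective_of_inj_surj (A B : Type) (f : A -> B) :
  injective f -> (forall b, exists a, f a = b) -> bijective f.
Proof.
  intros Hf Hs. destruct (choice _ Hs) as [g Hg]. exists g.
  split; [|exact Hg]. intros x. apply Hf, Hg.
Qed.

Lemma cantor_bernstein (A B : Type) : card_le A B -> card_le B A -> card_eq A B.
Proof.
  intros [f Hf] [g Hg].
  (* [Z]: the points whose backward orbit under [g o f] leaves the image of [g]. *)
  set (Z := fun a => exists n a0, (forall b, g b <> a0) /\ a = Nat.iter n (fun x => g (f x)) a0).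
  assert (HZ : forall a, ~ Z a -> exists b, g b = a).
  { intros a N. apply NNPP. intros M. apply N. exists 0, a.
    split; [|reflexivity]. intros b E. eauto. }
  assert (Step : forall a, Z a -> Z (g (f a))).
  { intros a [n [a0 [H1 H2]]]. exists (S n), a0. split; [exact H1|].
    simpl. congruence. }
  assert (Back : forall a, Z (g (f a)) -> Z a).
  { intros a [[|n] [a0 [H1 H2]]]; simpl in H2.
    - exfalso. exact (H1 _ H2).
    - exists n, a0. split; [exact H1|]. apply Hf, Hg, H2. }
  assert (H : forall a, exists b, (Z a -> b = f a) /\ (~ Z a -> g b = a)).
  { intros a. destruct (classic (Z a)) as [Y|N].
    - exists (f a). tauto.
    - destruct (HZ a N) as [b Hb]. exists b. tauto. }
  destruct (choice _ H) as [h Hh].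
  assert (h1 : forall a, Z a -> h a = f a) by apply Hh.
  assert (h2 : forall a, ~ Z a -> g (h a) = a) by apply Hh.
  exists h. apply bijective_of_inj_surj.
  - intros x y E. destruct (classic (Z x)) as [Zx|Nx], (classic (Z y)) as [Zy|Ny].
    + apply Hf. rewrite <- (h1 x Zx), E. apply h1, Zy.
    + exfalso. apply Ny. rewrite <- (h2 y Ny), <- E, (h1 x Zx). apply Step, Zx.
    + exfalso. apply Nx. rewrite <- (h2 x Nx), E, (h1 y Zy). apply Step, Zy.
    + rewrite <- (h2 x Nx), E. apply h2, Ny.
  - intros b. destruct (classic (Z (g b))) as [Y|N].
    + destruct Y as [[|n] [a0 [H1 H2]]]; simpl in H2.
      * exfalso. exact (H1 _ H2).
      * exists (Nat.iter n (fun x => g (f x)) a0). apply Hg in H2. rewrite H2.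
        apply h1. exists n, a0. split; [exact H1|reflexivity].
    + exists (g b). apply Hg, h2, N.
Qed.

(** The empty chain counts, so [P] must hold of the empty predicate. For this reason [card_square]
    adjoins its seed [G0] inside the predicate it maximizes. *)
Lemma zorn_union (X : Type) (P : (X -> Prop) -> Prop) :
  (forall F : (X -> Prop) -> Prop,
    (forall A, F A -> P A) ->
    (forall A B, F A -> F B -> (forall x, A x -> B x) \/ (forall x, B x -> A x)) ->
    P (fun x => exists2 A, F A & A x)) ->
  exists A, P A /\
    forall B, P B -> (forall x, A x -> B x) -> forall x, B x -> A x.
Proof.
  intros H. destruct (classical_sets.Zorn_bigcup (T := X) (P := P)) as [A [HA M]].
  - intros F HF Tot. exact (H F HF Tot).
  - exists A. split; [exact HA|]. intros B HB AB. apply NNPP. intros N.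
    apply (M B); [|exact HB]. split; assumption.
Qed.

(** A maximal partial injection is total on one side or the other, since otherwise an unmatched pair
    could be added to it. *)
Lemma card_le_total (A B : Type) : card_le A B \/ card_le B A.
Proof.
  set (P := fun G : A * B -> Prop =>
    forall a b a' b', G (a, b) -> G (a', b') -> (a = a' <-> b = b')).
  destruct (zorn_union (A * B) P) as [G [HG Max]].
  - intros F HF Tot a b a' b' [X HX Gx] [Y HY Gy].
    destruct (Tot X Y HX HY) as [I|I].
    + apply (HF Y HY); auto.
    + apply (HF X HX); auto.
  - destruct (classic (forall a, exists b, G (a, b))) as [D|D].
    + left. destruct (choice _ D) as [f Hf]. exists f.
      intros x y E. apply (HG _ _ _ _ (Hf x) (Hf y)), E.
    + destruct (classic (forall b, exists a, G (a, b))) as [R|R].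
      * right. destruct (choice _ R) as [f Hf]. exists f.
        intros x y E. apply (HG _ _ _ _ (Hf x) (Hf y)), E.
      * exfalso. apply not_all_ex_not in D. destruct D as [a Ha].
        apply not_all_ex_not in R. destruct R as [b Hb].
        apply Ha. exists b.
        apply (Max (fun p => G p \/ p = (a, b))); [|tauto|tauto].
        intros a1 b1 a2 b2 [G1|E1] [G2|E2].
        -- apply HG; assumption.
        -- injection E2 as -> ->. split; intros ->; exfalso; eauto.
        -- injection E1 as -> ->. split; intros <-; exfalso; eauto.
        -- injection E1 as -> ->. injection E2 as -> ->. tauto.
Qed.

(* A maximal injection A x A -> A with A infinite has |A| = |T|: otherwise the
   complement of A contains a copy of A, where the pairs of the union of A with
   that copy not in A x A can be sent. *)
Lemma card_square (T : Type) : infinite_type T -> card_le (T * T) T.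
Proof.
  intros [i Hi].
  (* The seed is the Cantor pairing on the image of [nat]; it makes the maximal set contain that
     image. *)
  set (G0 := fun q : (T * T) * T =>
    exists a b, q = ((i a, i b), i (to_nat (a, b)))).
  (* The set whose square is the domain of [G] is read off the diagonal. *)
  set (fld := fun (G : (T * T) * T -> Prop) x => exists z, G ((x, x), z)).
  set (good := fun G : (T * T) * T -> Prop =>
    (forall p z p' z', G (p, z) -> G (p', z') -> (p = p' <-> z = z')) /\
    (forall x y z, G ((x, y), z) -> fld G x /\ fld G y /\ fld G z) /\
    (forall x y, fld G x -> fld G y -> exists z, G ((x, y), z))).
  set (P := fun X => good (fun q => X q \/ G0 q)).
  destruct (zorn_union _ P) as [X [HX Max]].
  - intros F HF Tot.
    assert (C0 : good (fun q => False \/ G0 q)).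
    { split; [|split].
      - intros p z p' z' [[]|(a & b & E)] [[]|(a' & b' & E')].
        injection E as -> ->. injection E' as -> ->. split; intros E.
        + injection E as E1 E2. apply Hi in E1. apply Hi in E2. subst. reflexivity.
        + apply Hi in E. apply (to_nat_inj (a, b) (a', b')) in E. injection E as -> ->. reflexivity.
      - intros x y z [[]|(a & b & E)]. injection E as -> -> ->.
        repeat split; eexists; right; do 2 eexists; reflexivity.
      - intros x y [z [[]|(a & b & E)]] [z' [[]|(a' & b' & E')]].
        injection E as -> Ea _. injection E' as -> Eb _.
        exists (i (to_nat (a, a'))). right. exists a, a'. reflexivity. }
    set (W := fun q => (exists2 A, F A & A q) \/ G0 q).
    (* Any two facts about the union already hold in a single good relation: a member of the chain
       enlarged by [G0], or [G0] alone when the chain contributes nothing. *)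
    assert (C : forall q q', W q -> W q' -> exists Y,
      good Y /\ Y q /\ Y q' /\ forall r, Y r -> W r).
    { intros q q' [[A FA Aq]|H] [[B FB Bq]|H'].
      - destruct (Tot A B FA FB) as [I|I].
        + exists (fun r => B r \/ G0 r). refine (conj (HF B FB) (conj _ (conj _ _))); auto.
          intros r [r1|r1]; [left; exists B|right]; assumption.
        + exists (fun r => A r \/ G0 r). refine (conj (HF A FA) (conj _ (conj _ _))); auto.
          intros r [r1|r1]; [left; exists A|right]; assumption.
      - exists (fun r => A r \/ G0 r). refine (conj (HF A FA) (conj _ (conj _ _))); auto.
        intros r [r1|r1]; [left; exists A|right]; assumption.
      - exists (fun r => B r \/ G0 r). refine (conj (HF B FB) (conj _ (conj _ _))); auto.
        intros r [r1|r1]; [left; exists B|right]; assumption.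
      - exists (fun r => False \/ G0 r). refine (conj C0 (conj _ (conj _ _))); auto.
        intros r [[]|r1]; right; assumption. }
    change (good W). split; [|split].
    + intros p z p' z' H H'. destruct (C _ _ H H') as (Y & G & Y1 & Y2 & _).
      apply G; assumption.
    + intros x y z H. destruct (C _ _ H H) as (Y & G & Y1 & _ & I).
      destruct G as (_ & G & _). destruct (G _ _ _ Y1) as ([u1 ?] & [u2 ?] & [u3 ?]).
      repeat split; eexists; eauto.
    + intros x y [z H] [z' H']. destruct (C _ _ H H') as (Y & G & Y1 & Y2 & I).
      destruct G as (_ & _ & G). destruct (G x y) as [u Hu]; [eexists; eauto..|].
      exists u. auto.
  - set (G := fun q => X q \/ G0 q) in *. destruct HX as (Gi & Gf & Gt).
    fold G in Gi, Gf, Gt.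
    set (A := fld G) in *.
    assert (A0 : forall n, A (i n)).
    { intros n. exists (i (to_nat (n, n))). right. exists n, n. reflexivity. }
    assert (Hg : exists g : T -> T -> T, forall x y, A x -> A y -> G ((x, y), g x y)).
    { assert (H : forall p, exists z, A (fst p) -> A (snd p) -> G (p, z)).
      { intros [x y]. simpl. destruct (classic (A x /\ A y)) as [[Hx Hy]|N].
        - destruct (Gt x y Hx Hy) as [z Hz]. exists z. auto.
        - exists x. tauto. }
      destruct (choice _ H) as [g Hg]. exists (fun x y => g (x, y)).
      intros x y. exact (Hg (x, y)). }
    destruct Hg as [g Hg].
    assert (gA : forall x y, A x -> A y -> A (g x y)).
    { intros x y Hx Hy. apply (Gf x y), Hg; assumption. }
    assert (gi : forall x y x' y', A x -> A y -> A x' -> A y' ->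
      g x y = g x' y' -> x = x' /\ y = y').
    { intros x y x' y' Hx Hy Hx' Hy' E.
      apply (Gi _ _ _ _ (Hg _ _ Hx Hy) (Hg _ _ Hx' Hy')) in E.
      injection E as -> ->. auto. }
    (* A set [S] that injects into [A] can be merged with [A] inside [A]: the tags [i 0] and [i 1]
       separate the elements of [A] from the others. *)
    assert (K : forall (S : T -> Prop) (h : T -> T),
      (forall x, S x -> A (h x)) -> (forall x y, S x -> S y -> h x = h y -> x = y) ->
      exists k : T -> T, (forall x, A x \/ S x -> A (k x)) /\
        forall x y, A x \/ S x -> A y \/ S y -> k x = k y -> x = y).
    { intros S h hA hi.
      assert (N01 : i 0 <> i 1) by (intros E; apply Hi in E; discriminate).
      exists (fun x => if excluded_middle_informative (A x)
                       then g (i 0) x else g (i 1) (h x)).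
      split.
      - intros x Hx. destruct (excluded_middle_informative (A x)); [auto|].
        destruct Hx; [tauto|auto].
      - intros x y Hx Hy E.
        destruct (excluded_middle_informative (A x)), (excluded_middle_informative (A y)).
        + apply gi in E; auto. tauto.
        + destruct Hy; [tauto|]. apply gi in E; auto. tauto.
        + destruct Hx; [tauto|]. apply gi in E; auto. destruct E; congruence.
        + destruct Hx; [tauto|]. destruct Hy; [tauto|]. apply gi in E; auto.
          apply hi; tauto. }
    destruct (card_le_total {x | A x} {x | ~ A x}) as [[j Hj]|[h Hh]].
    + exfalso.
      assert (Hj' : exists j' : T -> T, (forall x, A x -> ~ A (j' x)) /\
        forall x y, A x -> A y -> j' x = j' y -> x = y).
      { exists (fun x => match excluded_middle_informative (A x) with
                         | left H => proj1_sig (j (exist _ x H)) | right _ => x end).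
        split.
        - intros x Hx. destruct (excluded_middle_informative (A x)); [|tauto].
          apply (proj2_sig (j _)).
        - intros x y Hx Hy.
          destruct (excluded_middle_informative (A x)); [|tauto].
          destruct (excluded_middle_informative (A y)); [|tauto].
          intros E. apply sig_eq, Hj in E. injection E. auto. }
      clear j Hj. destruct Hj' as [j [jA ji]].
      set (B := fun y => exists x, A x /\ j x = y).
      assert (Hh : exists h : T -> T, forall x, A x -> h (j x) = x).
      { assert (H : forall y, exists x, forall x', A x' -> y = j x' -> x = x').
        { intros y. destruct (classic (B y)) as [[x [Hx <-]]|N].
          - exists x. intros x' Hx' E. apply ji; assumption.
          - exists y. intros x' Hx' E. exfalso. apply N. exists x'. auto. }
        destruct (choice _ H) as [h Hh]. exists h. auto. }
      destruct Hh as [h Hh].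
      destruct (K B h) as [k [kA ki]].
      { intros y [x [Hx <-]]. rewrite Hh; assumption. }
      { intros y y' [x [Hx <-]] [x' [Hx' <-]]. rewrite !Hh by assumption. congruence. }
      set (AB := fun x => A x \/ B x) in *.
      assert (HAB : forall x, AB x -> A (k x)) by exact kA.
      (* The new pairs take values in [B], the copy of [A] under [j], which is disjoint from all the
         old values. *)
      set (Nw := fun q : (T * T) * T => exists x y,
        AB x /\ AB y /\ ~ (A x /\ A y) /\ q = ((x, y), j (g (k x) (k y)))).
      assert (F' : forall x, AB x -> fld (fun q => G q \/ Nw q) x).
      { intros x Hx. destruct (classic (A x)) as [Ax|Nx].
        - exists (g x x). left. apply Hg; assumption.
        - eexists. right. exists x, x. repeat split; auto. tauto. }
      assert (F'' : forall x, fld (fun q => G q \/ Nw q) x -> AB x).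
      { intros x [z [H|(u & v & H1 & H2 & _ & E)]].
        - left. apply (Gf _ _ _ H).
        - injection E as -> _ _. exact H1. }
      assert (N' : P (fun q => X q \/ Nw q)).
      { unfold P. replace (fun q => (X q \/ Nw q) \/ G0 q) with (fun q => G q \/ Nw q).
        2:{ apply functional_extensionality. intros q. apply propositional_extensionality.
            unfold G. tauto. }
        assert (Dis : forall x y z, AB x -> AB y -> ~ G (z, j (g (k x) (k y)))).
        { intros x y [z1 z2] Hx Hy H. apply (jA (g (k x) (k y))); [auto|].
          apply (Gf _ _ _ H). }
        split; [|split].
        - intros p z p' z' [H|(x & y & Hx & Hy & Nxy & E)]
            [H'|(x' & y' & Hx' & Hy' & Nxy' & E')].
          + apply Gi; assumption.
          + injection E' as -> ->. split; intros ->.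
            * exfalso. apply Nxy'. apply Gf in H. tauto.
            * exfalso. exact (Dis _ _ _ Hx' Hy' H).
          + injection E as -> ->. split; intros E.
            * exfalso. apply Nxy. subst p'. apply Gf in H'. tauto.
            * subst z'. exfalso. exact (Dis _ _ _ Hx Hy H').
          + injection E as -> ->. injection E' as -> ->. split; intros E.
            * injection E as -> ->. reflexivity.
            * apply ji in E; auto. apply gi in E; auto.
              destruct E as [E1 E2]. apply ki in E1; auto. apply ki in E2; auto.
              congruence.
        - intros x y z [H|(x' & y' & Hx & Hy & Nxy & E)].
          + destruct (Gf _ _ _ H) as (H1 & H2 & H3).
            repeat split; apply F'; left; assumption.
          + injection E as -> -> ->. repeat split; apply F'; auto.
            right. eexists. split; [|reflexivity]. auto.
        - intros x y Hx Hy. apply F'' in Hx. apply F'' in Hy.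
          destruct (classic (A x /\ A y)) as [[Ax Ay]|Nxy].
          + exists (g x y). left. auto.
          + eexists. right. exists x, y. repeat split; auto. }
      assert (NA : ~ A (j (i 0))) by auto.
      apply NA. eexists. left.
      apply (Max _ N'); [tauto|]. right.
      exists (j (i 0)), (j (i 0)).
      assert (Hb : AB (j (i 0))) by (right; exists (i 0); auto).
      repeat split; auto; tauto.
    + assert (Hh' : exists h' : T -> T, (forall x, ~ A x -> A (h' x)) /\
        forall x y, ~ A x -> ~ A y -> h' x = h' y -> x = y).
      { exists (fun x => match excluded_middle_informative (~ A x) with
                         | left H => proj1_sig (h (exist _ x H)) | right _ => x end).
        split.
        - intros x Hx. destruct (excluded_middle_informative (~ A x)); [|tauto].
          apply (proj2_sig (h _)).
        - intros x y Hx Hy.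
          destruct (excluded_middle_informative (~ A x)); [|tauto].
          destruct (excluded_middle_informative (~ A y)); [|tauto].
          intros E. apply sig_eq, Hh in E. injection E. auto. }
      destruct Hh' as [h' [H1 H2]].
      destruct (K (fun x => ~ A x) h' H1 H2) as [k [kA ki]].
      exists (fun p => g (k (fst p)) (k (snd p))).
      intros [x y] [x' y'] E. simpl in E.
      apply gi in E; try (apply kA; apply classic).
      destruct E as [E1 E2].
      apply ki in E1; try apply classic. apply ki in E2; try apply classic. congruence.
Qed.

Lemma infinite_of_card_le (A B : Type) : infinite_type A -> card_le A B -> infinite_type B.
Proof. apply card_le_trans. Qed.

Lemma card_le_list (A B : Type) : card_le A B -> card_le (list A) (list B).
Proof.
  intros [f Hf]. exists (map f). intros l. induction l as [|x l IH]; intros [|y l'] E;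
    try discriminate; [reflexivity|].
  injection E as E1 E2. apply Hf in E1. apply IH in E2. congruence.
Qed.

(** Lists are coded by iterated pairing. The length is stored too, because the code of the empty
    list may also be the code of a pair. *)
Lemma card_list (T : Type) : infinite_type T -> card_le (list T) T.
Proof.
  intros HT. destruct (card_square T HT) as [p Hp]. destruct HT as [i Hi].
  set (tup := fix tup (l : list T) := match l with
    | nil => i 0 | x :: l => p (x, tup l) end).
  exists (fun l => p (i (length l), tup l)).
  intros l l' E. apply Hp in E. injection E as E1 E2. apply Hi in E1.
  revert l' E1 E2. induction l as [|x l IH]; intros [|y l'] E1 E2; try discriminate.
  - reflexivity.
  - simpl in E2. apply Hp in E2. injection E2 as -> E2. f_equal.
    apply IH; [injection E1; auto|exact E2].
Qed.

Lemma card_sum (A B T : Type) :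
  infinite_type T -> card_le A T -> card_le B T -> card_le (A + B) T.
Proof.
  intros HT [f Hf] [g Hg]. destruct (card_square T HT) as [p Hp]. destruct HT as [i Hi].
  exists (fun x => match x with inl a => p (i 0, f a) | inr b => p (i 1, g b) end).
  intros [a|b] [a'|b'] E; apply Hp in E.
  - injection E as E1. f_equal. auto.
  - injection E as E0 E1. apply Hi in E0. discriminate.
  - injection E as E0 E1. apply Hi in E0. discriminate.
  - injection E as E1. f_equal. auto.
Qed.

(** Applied to sets of at most three elements, the first clause gives reflexivity and totality and,
    with the second, transitivity. *)
Lemma well_order_exists (U : Type) :
  exists R : U -> U -> Prop,
    (forall A : U -> Prop, (exists x, A x) -> exists m, A m /\ forall x, A x -> R m x) /\
    (forall x y, R x y -> R y x -> x = y).
Proof.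
  (* [boolp.Peq] reduces to types with decidable equality, for which the well-ordering principle is
     stated. *)
  revert U. refine (boolp.Peq (G := fun U => exists R : U -> U -> Prop,
    (forall A : U -> Prop, (exists x, A x) -> exists m, A m /\ forall x, A x -> R m x) /\
    (forall x y, R x y -> R y x -> x = y)) _).
  intros E. destruct (wochoice.well_ordering_principle E) as [R HR].
  set (U := eqtype.Equality.sort E) in *.
  assert (M : forall A : U -> Prop, (exists x, A x) ->
    exists! m, A m /\ forall x, A x -> R m x = true).
  { intros A [x Hx].
    assert (conv : forall y, boolp.asbool (A y) = true <-> A y).
    { intros y. destruct (boolp.asboolP (A y)); split; intros; auto; discriminate. }
    destruct (HR (fun y => boolp.asbool (A y))) as [m [[H1 H2] H3]].
    - exists x. apply conv, Hx.
    - exists m. split; [split|].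
      + apply conv, H1.
      + intros y Hy. apply H2. apply conv, Hy.
      + intros m' [Hm' Hm'']. apply H3. split.
        * apply conv, Hm'.
        * intros y Hy. apply Hm''. apply conv, Hy. }
  exists (fun x y => R x y = true). split.
  - intros A HA. destruct (M A HA) as [m [Hm _]]. eauto.
  - intros x y Hxy Hyx. destruct (M (fun z => z = x \/ z = y)) as [m [[Hm _] Un]]; [eauto|].
    assert (Hr : forall z, R z z = true).
    { intros z. destruct (M (fun t => t = z)) as [m' [[Em H] _]]; [eauto|].
      subst m'. auto. }
    rewrite <- (Un x), <- (Un y); [reflexivity|..].
    + split; [tauto|]. intros u [->| ->]; auto.
    + split; [tauto|]. intros u [->| ->]; auto.
Qed.

(* The least initial segment of U of cardinality above K. *)
Lemma succ_card_exists (K U : Type) :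
  infinite_type K -> card_lt K U ->
  exists T : Type, is_succ_card K T /\ card_le T U.
Proof.
  intros HK [KU UK]. destruct (well_order_exists U) as [R [HR Anti]].
  assert (Tot : forall x y, R x y \/ R y x).
  { intros x y. destruct (HR (fun z => z = x \/ z = y)) as [m [[->| ->] H]]; eauto. }
  set (seg := fun u x => R x u /\ x <> u).
  (* When no proper initial segment exceeds [K], all of [U] is taken. *)
  assert (HI : exists I : U -> Prop, ~ card_le {x | I x} K /\
    forall u, I u -> card_le {x | seg u x} K).
  { destruct (classic (exists u, ~ card_le {x | seg u x} K)) as [E|N].
    - destruct (HR _ E) as [u [Hu Min]]. exists (seg u). split; [exact Hu|].
      intros v [Hv1 Hv2]. apply NNPP. intros N. apply Hv2.
      apply Anti; [exact Hv1|]. apply Min, N.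
    - exists (fun _ => True). split.
      + intros H. apply UK. eapply card_le_trans; [|exact H].
        exists (fun x => exist _ x I). intros x y E. injection E. auto.
      + intros u _. apply NNPP. eauto. }
  destruct HI as [I [HI Hseg]]. exists {x | I x}.
  split; [|apply card_le_sig].
  assert (KI : card_lt K {x | I x}).
  { split; [|exact HI]. destruct (card_le_total K {x | I x}); tauto. }
  split; [exact KI|]. intros S [KS SK].
  destruct (card_le_total {x | I x} S) as [H|[f Hf]]; [exact H|].
  assert (HS : infinite_type S) by (eapply infinite_of_card_le; eassumption).
  (* The image of [f] is cofinal in [I]: otherwise [S] would embed in a proper segment, hence in
     [K]. *)
  assert (Cof : forall x, I x -> exists s, x = proj1_sig (f s) \/ seg (proj1_sig (f s)) x).
  { intros x Hx. apply NNPP. intros N. apply SK.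
    eapply card_le_trans; [|apply (Hseg x Hx)].
    assert (Hs : forall s, seg x (proj1_sig (f s))).
    { intros s. destruct (Tot (proj1_sig (f s)) x) as [H|H].
      - split; [exact H|]. intros E. apply N. exists s. auto.
      - exfalso. apply N. exists s. destruct (classic (x = proj1_sig (f s))); [auto|].
        right. split; auto. }
    exists (fun s => exist _ (proj1_sig (f s)) (Hs s)).
    intros s s' E. injection E as E. apply Hf, sig_eq, E. }
  assert (Hin : forall s, exists e : U -> K, forall x y,
    seg (proj1_sig (f s)) x -> seg (proj1_sig (f s)) y -> e x = e y -> x = y).
  { intros s. destruct (Hseg _ (proj2_sig (f s))) as [e He].
    destruct HK as [i _].
    exists (fun x => match excluded_middle_informative (seg (proj1_sig (f s)) x) with
                     | left H => e (exist _ x H) | right _ => i 0 end).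
    intros x y Hx Hy.
    destruct (excluded_middle_informative (seg (proj1_sig (f s)) x)); [|tauto].
    destruct (excluded_middle_informative (seg (proj1_sig (f s)) y)); [|tauto].
    intros E. apply He in E. injection E. auto. }
  destruct (choice _ Hin) as [e He]. clear Hin.
  destruct (choice _ (fun t : {x | I x} => Cof _ (proj2_sig t))) as [c Hc]. clear Cof.
  (* A point of [I] is either [f (c t)] itself or lies in the segment below it, where [e] numbers it
     by an element of [K]. *)
  eapply card_le_trans with (S + (S * K))%type.
  - exists (fun t => if excluded_middle_informative (proj1_sig t = proj1_sig (f (c t)))
                     then inl (c t) else inr (c t, e (c t) (proj1_sig t))).
    intros t t'.
    destruct (excluded_middle_informative (proj1_sig t = proj1_sig (f (c t)))) as [E|E],
      (excluded_middle_informative (proj1_sig t' = proj1_sig (f (c t')))) as [E'|E'];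
      intros H; try discriminate.
    + injection H as H. apply sig_eq. rewrite E, E', H. reflexivity.
    + injection H as H1 H2. apply sig_eq.
      destruct (Hc t) as [|Ht]; [tauto|]. destruct (Hc t') as [|Ht']; [tauto|].
      rewrite H1 in H2, Ht. eapply He; eassumption.
  - apply card_sum; [exact HS|apply card_le_refl|].
    eapply card_le_trans; [|apply card_square, HS].
    destruct KS as [k Hk]. exists (fun p => (fst p, k (snd p))).
    intros [s x] [s' x'] E. injection E as -> E. apply Hk in E. congruence.
Qed.

(** * Löwenheim-Skolem and Scott isomorphism *)

Lemma eval_ext {L} (M : structure L) (t : term L) : forall k (e e' : nat -> dom M),
  (forall n, n < k -> e n = e' n) -> term_bound L k t -> eval M e t = eval M e' t.
Proof.
  induction t as [n|f ts IH]; intros k e e' H B; simpl in *.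
  - auto.
  - f_equal. apply functional_extensionality. intros i. eapply IH; eauto.
Qed.

Lemma sat_ext {L} (M : structure L) (phi : formula L) : forall k (e e' : nat -> dom M),
  (forall n, n < k -> e n = e' n) -> fbound L k phi -> (sat M e phi <-> sat M e' phi).
Proof.
  induction phi as [t u|r ts|p IH|ps IH|p IH]; intros k e e' H B; simpl in *.
  - rewrite (eval_ext M t k e e'), (eval_ext M u k e e'); tauto.
  - replace (fun i => eval M e' (ts i)) with (fun i => eval M e (ts i)); [tauto|].
    apply functional_extensionality. intros i. eapply eval_ext; eauto.
  - rewrite (IH k e e'); tauto.
  - split; intros S n; apply (IH n k e e' H (B n)), S.
  - assert (E : forall a, sat M (scons a e) p <-> sat M (scons a e') p).
    { intros a. apply (IH (S k)); [|exact B].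
      intros [|n] Hn; [reflexivity|]. simpl. apply H. lia. }
    split; intros [a Ha]; exists a; apply E, Ha.
Qed.

Lemma sat_sentence {L} (M : structure L) (phi : formula L) (e e' : nat -> dom M) :
  sentence L phi -> sat M e phi -> sat M e' phi.
Proof. intros B. apply (sat_ext M phi 0); [lia|exact B]. Qed.

Definition isomorphism {L} (M N : structure L) (h : dom M -> dom N) : Prop :=
  bijective h /\
  (forall f (xs : arg (far L f) -> dom M),
    h (ifun M f xs) = ifun N f (fun i => h (xs i))) /\
  (forall r (xs : arg (rar L r) -> dom M),
    irel M r xs <-> irel N r (fun i => h (xs i))).

Lemma sat_isomorphism {L} (M N : structure L) (h : dom M -> dom N) :
  isomorphism M N h ->
  forall phi (e : nat -> dom M), sat M e phi <-> sat N (fun n => h (e n)) phi.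
Proof.
  intros [[g [gh hg]] [Hf Hr]].
  assert (Ht : forall t e, h (eval M e t) = eval N (fun n => h (e n)) t).
  { induction t as [n|f ts IH]; intros e; simpl; [reflexivity|].
    rewrite Hf. f_equal. apply functional_extensionality. intros i. apply IH. }
  induction phi as [t u|r ts|p IH|ps IH|p IH]; intros e; simpl.
  - rewrite <- !Ht. split; [congruence|]. intros E.
    rewrite <- (gh (eval M e t)), E. apply gh.
  - rewrite Hr. replace (fun i => eval N (fun n => h (e n)) (ts i))
      with (fun i => h (eval M e (ts i))); [tauto|].
    apply functional_extensionality. intros i. apply Ht.
  - rewrite IH. tauto.
  - split; intros H n; apply IH, H.
  - assert (E : forall a, (fun n => h (scons a e n)) = scons (h a) (fun n => h (e n))).
    { intros a. apply functional_extensionality. intros [|n]; reflexivity. }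
    split.
    + intros [a Ha]. exists (h a). rewrite <- E. apply IH, Ha.
    + intros [b Hb]. exists (g b). apply IH. rewrite E, hg. exact Hb.
Qed.

(** * Skolem hulls and downward Löwenheim-Skolem *)

Definition closed_under_functions {L} (M : structure L) (N : dom M -> Prop) : Prop :=
  forall f (xs : arg (far L f) -> dom M), (forall i, N (xs i)) -> N (ifun M f xs).

Definition substructure {L} (M : structure L) (N : dom M -> Prop)
  (HN : closed_under_functions M N) (ne : inhabited {x | N x}) : structure L :=
  {| dom := {x | N x};
     dom_inhabited := ne;
     ifun := fun f xs => exist N (ifun M f (fun i => proj1_sig (xs i)))
                           (HN f _ (fun i => proj2_sig (xs i)));
     irel := fun r xs => irel M r (fun i => proj1_sig (xs i)) |}.

Lemma eval_substructure {L} (M : structure L) N HN ne (t : term L) :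
  forall e, proj1_sig (eval (substructure M N HN ne) e t) =
    eval M (fun n => proj1_sig (e n)) t.
Proof.
  induction t as [n|f ts IH]; intros e; simpl; [reflexivity|].
  f_equal. apply functional_extensionality. intros i. apply IH.
Qed.

Lemma proj1_scons (A : Type) (Q : A -> Prop) (a : {x | Q x}) (e : nat -> {x | Q x}) :
  (fun n => proj1_sig (scons a e n)) = scons (proj1_sig a) (fun n => proj1_sig (e n)).
Proof. apply functional_extensionality. intros [|n]; reflexivity. Qed.

(** Witnesses are demanded only for the subformulas of [phi]. These are countably many, so countably
    many Skolem functions suffice; preserving all infinitary formulas could require uncountably
    many. *)
Fixpoint tarski_vaught {L} (M : structure L) (N : dom M -> Prop) (phi : formula L) : Prop :=
  match phi with
  | Eq _ _ | Rel _ _ => True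
  | Neg p => tarski_vaught M N p
  | BigAnd ps => forall n, tarski_vaught M N (ps n)
  | Ex p => tarski_vaught M N p /\
      forall e : nat -> dom M, (forall n, N (e n)) ->
        (exists a, sat M (scons a e) p) -> exists a, N a /\ sat M (scons a e) p
  end.

Lemma sat_substructure {L} (M : structure L) N HN ne (phi : formula L) :
  tarski_vaught M N phi ->
  forall e, sat (substructure M N HN ne) e phi <->
    sat M (fun n => proj1_sig (e n)) phi.
Proof.
  induction phi as [t u|r ts|p IH|ps IH|p IH]; intros TV e.
  - cbn [sat]. rewrite <- !(eval_substructure M N HN ne).
    split; [intros ->; reflexivity|apply sig_eq].
  - cbn [sat]. cbn [irel substructure].
    replace (fun i => eval M (fun n => proj1_sig (e n)) (ts i))
      with (fun i => proj1_sig (eval (substructure M N HN ne) e (ts i))); [tauto|].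
    apply functional_extensionality. intros i. apply eval_substructure.
  - cbn [sat]. rewrite IH; [tauto|exact TV].
  - cbn [sat]. split; intros H n; apply (IH n (TV n)), H.
  - destruct TV as [TV W]. cbn [sat]. split.
    + intros [a Ha]. exists (proj1_sig a). rewrite <- proj1_scons.
      apply (IH TV), Ha.
    + intros H. destruct (W _ (fun n => proj2_sig (e n)) H) as [a [Na Ha]].
      exists (exist _ a Na). apply (IH TV). rewrite proj1_scons. exact Ha.
Qed.

Lemma map_nth_seq (A : Type) (e : nat -> A) (d : A) k n :
  n < k -> nth n (map e (seq 0 k)) d = e n.
Proof.
  intros H. rewrite nth_indep with (d' := e 0) by (rewrite length_map, length_seq; exact H).
  rewrite map_nth, seq_nth by exact H. reflexivity.
Qed.

(** The bound [k] leaves each subformula finitely many free variables, so its Skolem function acts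
    on finite lists. The functions for a countable conjunction are numbered by pairs. *)
Lemma skolem_operations {L} (M : structure L) (phi : formula L) :
  forall k, fbound L k phi ->
  exists ops : nat -> list (dom M) -> dom M, forall N : dom M -> Prop,
    (forall j l, Forall N l -> N (ops j l)) -> tarski_vaught M N phi.
Proof.
  destruct (dom_inhabited _ M) as [d].
  induction phi as [t u|r ts|p IH|ps IH|p IH]; intros k B; cbn [fbound tarski_vaught] in *.
  - exists (fun _ _ => d). auto.
  - exists (fun _ _ => d). auto.
  - apply (IH k B).
  - assert (H : forall n, exists ops : nat -> list (dom M) -> dom M,
      forall N : dom M -> Prop,
      (forall j l, Forall N l -> N (ops j l)) -> tarski_vaught M N (ps n)).
    { intros n. apply (IH n k), B. }
    destruct (choice _ H) as [ops Hops].
    exists (fun j => ops (fst (of_nat j)) (snd (of_nat j))).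
    intros N HN n. apply Hops. intros j l Hl. specialize (HN (to_nat (n, j)) l Hl).
    rewrite cancel_of_to in HN. exact HN.
  - destruct (IH (S k) B) as [ops Hops].
    assert (W : forall l, exists a, (exists a', sat M (scons a' (fun n => nth n l d)) p) ->
      sat M (scons a (fun n => nth n l d)) p).
    { intros l.
      destruct (classic (exists a', sat M (scons a' (fun n => nth n l d)) p)) as [[a Ha]|N].
      - exists a. auto.
      - exists d. tauto. }
    destruct (choice _ W) as [w Hw].
    exists (fun j => match j with 0 => w | S j => ops j end).
    intros N HN. split.
    + apply Hops. intros j l Hl. exact (HN (S j) l Hl).
    + intros e He Ha. set (l := map e (seq 0 k)).
      assert (E : forall a, sat M (scons a e) p <-> sat M (scons a (fun n => nth n l d)) p).
      { intros a. apply (sat_ext M p (S k)); [|exact B].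
        intros [|n] Hn; [reflexivity|]. simpl. symmetry. apply map_nth_seq. lia. }
      exists (w l). split.
      * apply (HN 0 l). apply Forall_forall. intros x Hx. apply in_map_iff in Hx.
        destruct Hx as [n [<- _]]. apply He.
      * apply E, Hw. destruct Ha as [a Ha]. exists a. apply E, Ha.
Qed.

(* Elements of the hull are the values of programs for a stack machine, which are
   words over [X + nat]: a letter pushes a generator or applies an operation. *)
Lemma hull (A X : Type) (f : X -> A) (ops : nat -> list A -> A) :
  exists N : A -> Prop, (forall x, N (f x)) /\
    (forall j l, Forall N l -> N (ops j l)) /\ card_le {a | N a} (list (X + nat)).
Proof.
  set (step := fun (st : list A) (t : X + nat) => match t with
    | inl x => f x :: st
    | inr c => ops (fst (of_nat c)) (firstn (snd (of_nat c)) st) ::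
               skipn (snd (of_nat c)) st end).
  (* The program must work above every stack, so that the programs of several arguments can be
     concatenated. *)
  set (N := fun a => exists w, forall st, fold_left step w st = a :: st).
  exists N. split; [|split].
  - intros x. exists [inl x]. reflexivity.
  - intros j l Hl.
    assert (Hw : exists w, forall st, fold_left step w st = l ++ st).
    { induction Hl as [|a l [w Hw] Hl [w' Hw']].
      - exists []. reflexivity.
      - exists (w' ++ w). intros st. rewrite fold_left_app, Hw', Hw. reflexivity. }
    destruct Hw as [w Hw]. exists (w ++ [inr (to_nat (j, length l))]).
    intros st. rewrite fold_left_app, Hw. cbn [fold_left step].
    rewrite cancel_of_to. cbn [fst snd].
    rewrite firstn_app, Nat.sub_diag, firstn_all, skipn_app, Nat.sub_diag, skipn_all.
    simpl. rewrite app_nil_r. reflexivity.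
  - destruct (choice _ (fun a : {a | N a} => proj2_sig a)) as [w Hw].
    exists w. intros a b E. apply sig_eq.
    assert (Ha := Hw a []). rewrite E, (Hw b []) in Ha. injection Ha. auto.
Qed.

Lemma arg_list (A : Type) n (xs : arg n -> A) : exists l : list A,
  (forall i, In (xs i) l) /\ forall x, In x l -> exists i, xs i = x.
Proof.
  exists (flat_map (fun k => match lt_dec k n with
    | left H => [xs (exist _ k H)] | right _ => [] end) (seq 0 n)).
  split.
  - intros [i Hi]. apply in_flat_map. exists i. split; [apply in_seq; lia|].
    destruct (lt_dec i n) as [H|H]; [|tauto].
    rewrite (proof_irrelevance _ Hi H). left. reflexivity.
  - intros x Hx. apply in_flat_map in Hx. destruct Hx as [k [_ Hx]].
    destruct (lt_dec k n); [|destruct Hx]. destruct Hx as [<-|[]]. eauto.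
Qed.

(** The submodel is the hull of the image of [f] under the Skolem functions of [phi] and the
    function symbols. An empty [X] gives countable models; an [X] of size [K^+] serves to exclude
    models above [K]. *)
Theorem lowenheim_skolem {L} (M : structure L) (phi : formula L)
  (X : Type) (f : X -> dom M) :
  sentence L phi ->
  exists (N : structure L) (g : dom N -> dom M),
    injective g /\ (forall x, exists y, g y = f x) /\
    card_le (dom N) (list (X + nat)) /\
    (forall e, sat N e phi <-> sat M (fun n => g (e n)) phi).
Proof.
  intros B. destruct (skolem_operations M phi 0 B) as [ops Hops].
  destruct (dom_inhabited _ M) as [d]. destruct (fsym_countable L) as [c Hc].
  (* Function symbols become list operations indexed by their codes under [c]; an index coding no
     symbol gets a constant operation. *)
  assert (Hfun : forall j, exists op : list (dom M) -> dom M,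
    forall s, c s = j -> forall xs, op (map xs (seq 0 (far L s))) =
      ifun M s (fun i => xs (proj1_sig i))).
  { intros j. destruct (classic (exists s, c s = j)) as [[s Hs]|N].
    - exists (fun l => ifun M s (fun i => nth (proj1_sig i) l d)).
      intros s' Hs' xs. assert (s' = s) as -> by (apply Hc; congruence).
      f_equal. apply functional_extensionality. intros [i Hi]. apply map_nth_seq, Hi.
    - exists (fun _ => d). intros s Hs. exfalso. eauto. }
  destruct (choice _ Hfun) as [fop Hfop'].
  assert (Hfop : forall s xs, fop (c s) (map xs (seq 0 (far L s))) =
      ifun M s (fun i => xs (proj1_sig i))) by (intros s; apply Hfop'; reflexivity).
  clear Hfop' Hfun.
  (* Operations are numbered by pairs: first component 0 for the Skolem functions, any other for the
     function symbols. *)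
  destruct (hull (dom M) X f (fun j => match fst (of_nat j) with
    | 0 => ops (snd (of_nat j)) | _ => fop (snd (of_nat j)) end))
    as [N [HX [Hcl Hcard]]].
  assert (Hcl0 : forall j l, Forall N l -> N (ops j l)).
  { intros j l Hl. specialize (Hcl (to_nat (0, j)) l Hl).
    rewrite cancel_of_to in Hcl. exact Hcl. }
  assert (Hcl1 : forall j l, Forall N l -> N (fop j l)).
  { intros j l Hl. specialize (Hcl (to_nat (1, j)) l Hl).
    rewrite cancel_of_to in Hcl. exact Hcl. }
  assert (HN : closed_under_functions M N).
  { intros s xs Hxs.
    set (ys := fun k => match lt_dec k (far L s) with
      | left H => xs (exist _ k H) | right _ => ops 0 [] end).
    assert (E : xs = fun i => ys (proj1_sig i)).
    { apply functional_extensionality. intros [k Hk]. unfold ys. simpl.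
      destruct (lt_dec k (far L s)) as [H|H]; [|tauto].
      f_equal. f_equal. apply proof_irrelevance. }
    rewrite E, <- Hfop. apply Hcl1, Forall_forall. intros x Hx.
    apply in_map_iff in Hx. destruct Hx as [k [<- _]]. unfold ys.
    destruct (lt_dec k (far L s)); auto. }
  assert (ne : inhabited {x | N x}).
  { constructor. exists (ops 0 []). auto. }
  exists (substructure M N HN ne), (@proj1_sig _ _). repeat split.
  - intros x y. apply sig_eq.
  - intros x. exists (exist _ (f x) (HX x)). reflexivity.
  - exact Hcard.
  - apply sat_substructure, Hops, Hcl0.
  - apply sat_substructure, Hops, Hcl0.
Qed.

Lemma sat_Impl {L} (M : structure L) e (p q : formula L) :
  sat M e (Impl L p q) <-> (sat M e p -> sat M e q).
Proof.
  simpl. split.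
  - intros H Hp. apply NNPP. intros Nq. apply H. intros [|n]; assumption.
  - intros H S. apply (S 1), H, (S 0).
Qed.

Lemma models_of_sat {L} (M : structure L) (phi : formula L) (e : nat -> dom M) :
  sentence L phi -> sat M e phi -> models M phi.
Proof. intros B H e'. exact (sat_sentence M phi e e' B H). Qed.

Lemma countable_model {L} (M : structure L) (phi : formula L) :
  sentence L phi -> models M phi ->
  exists N : structure L, models N phi /\ countable_type (dom N).
Proof.
  intros B H.
  destruct (lowenheim_skolem M phi False (fun x => match x with end) B)
    as (N & g & _ & _ & C & S).
  exists N. split.
  - intros e. apply S, H.
  - eapply card_le_trans; [exact C|]. eapply card_le_trans; [apply card_le_list|].
    + apply card_sum with (T := nat); [apply card_le_refl| |apply card_le_refl].
      exists (fun x : False => match x with end). intros [].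
    + apply card_list, card_le_refl.
Qed.

(** A model above [K] would contain a copy of [K^+], and Löwenheim-Skolem would cut it down to
    cardinality exactly [K^+]. *)
Lemma no_model_above {L} (K : Type) (sigma : formula L) :
  infinite_type K -> sentence L sigma ->
  (forall T : Type, is_succ_card K T ->
     ~ exists M : structure L, models M sigma /\ card_eq (dom M) T) ->
  forall M : structure L, models M sigma -> card_le (dom M) K.
Proof.
  intros HK B HT M HM. apply NNPP. intros Nle.
  assert (Lt : card_lt K (dom M)).
  { split; [|exact Nle]. destruct (card_le_total K (dom M)); tauto. }
  destruct (succ_card_exists K (dom M) HK Lt) as [T [ST [f Hf]]].
  assert (IT : infinite_type T).
  { eapply infinite_of_card_le; [exact HK|apply ST]. }
  destruct (lowenheim_skolem M sigma T f B) as (N & g & Hg & Hr & C & S).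
  apply (HT T ST). exists N. split.
  - intros e. apply S, HM.
  - apply cantor_bernstein.
    + eapply card_le_trans; [exact C|]. eapply card_le_trans; [apply card_le_list|].
      * apply card_sum; [exact IT|apply card_le_refl|exact IT].
      * apply card_list, IT.
    + destruct (choice _ Hr) as [h Hh]. exists h.
      intros x y E. apply Hf. rewrite <- (Hh x), <- (Hh y). congruence.
Qed.

(** [R] is the family of finite conditions. The last conclusion puts any finitely many values of [f]
    into one condition, so finitary properties of [R] pass to [f]. *)
Lemma back_and_forth (A B : Type) (R : list (A * B) -> Prop) :
  countable_type A -> countable_type B -> R [] ->
  (forall l a, R l -> exists b, R ((a, b) :: l)) ->
  (forall l b, R l -> exists a, R ((a, b) :: l)) ->
  (forall l a b a' b', R l -> In (a, b) l -> In (a', b') l -> (a = a' <-> b = b')) ->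
  exists f : A -> B, bijective f /\
    forall xs : list A, exists l, R l /\ forall x, In x xs -> In (x, f x) l.
Proof.
  intros [cA HA] [cB HB] R0 Forth Back Comp.
  assert (Step : forall (l : {l | R l}) n, exists l' : {l | R l},
    (forall p, In p (proj1_sig l) -> In p (proj1_sig l')) /\
    (forall a, cA a = n -> exists b, In (a, b) (proj1_sig l')) /\
    (forall b, cB b = n -> exists a, In (a, b) (proj1_sig l'))).
  { intros [l Hl] n.
    assert (S1 : exists l1, R l1 /\ (forall p, In p l -> In p l1) /\
      forall a, cA a = n -> exists b, In (a, b) l1).
    { destruct (classic (exists a, cA a = n)) as [[a Ha]|N].
      - destruct (Forth l a Hl) as [b Hb]. exists ((a, b) :: l).
        split; [exact Hb|]. split; [simpl; auto|]. intros a' Ha'.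
        assert (a' = a) as -> by (apply HA; congruence). exists b. left. reflexivity.
      - exists l. split; [exact Hl|]. split; [auto|]. intros a Ha. exfalso. eauto. }
    destruct S1 as (l1 & R1 & I1 & T1).
    destruct (classic (exists b, cB b = n)) as [[b Hb]|N].
    - destruct (Back l1 b R1) as [a Ha]. exists (exist _ ((a, b) :: l1) Ha). simpl.
      split; [auto|]. split.
      + intros a' Ha'. destruct (T1 a' Ha') as [b' Hb']. exists b'. auto.
      + intros b' Hb'. assert (b' = b) as -> by (apply HB; congruence). exists a. auto.
    - exists (exist _ l1 R1). simpl. split; [auto|]. split; [auto|].
      intros b Hb. exfalso. eauto. }
  destruct (choice _ (fun p => Step (fst p) (snd p))) as [next Hnext].
  set (chain := fix chain n := match n with
    | 0 => exist R [] R0 | S n => next (chain n, n) end).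
  assert (Mono : forall n m p, n <= m ->
    In p (proj1_sig (chain n)) -> In p (proj1_sig (chain m))).
  { intros n m p H Hp. induction H; [exact Hp|]. apply (Hnext (chain m, m)), IHle. }
  assert (TA : forall a, exists b, In (a, b) (proj1_sig (chain (S (cA a))))).
  { intros a. apply (Hnext (chain (cA a), cA a)). reflexivity. }
  assert (TB : forall b, exists a, In (a, b) (proj1_sig (chain (S (cB b))))).
  { intros b. apply (Hnext (chain (cB b), cB b)). reflexivity. }
  assert (Comp' : forall n m a b a' b', In (a, b) (proj1_sig (chain n)) ->
    In (a', b') (proj1_sig (chain m)) -> (a = a' <-> b = b')).
  { intros n m a b a' b' H H'.
    apply (Comp _ _ _ _ _ (proj2_sig (chain (max n m)))).
    - eapply Mono; [|exact H]. lia.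
    - eapply Mono; [|exact H']. lia. }
  destruct (choice _ TA) as [f Hf]. exists f. split.
  - apply bijective_of_inj_surj.
    + intros a a' E. eapply Comp'; [apply Hf|apply Hf|exact E].
    + intros b. destruct (TB b) as [a Ha]. exists a.
      eapply Comp'; [apply Hf|exact Ha|reflexivity].
  - intros xs. exists (proj1_sig (chain (S (list_max (map cA xs))))).
    split; [apply (proj2_sig (chain _))|].
    intros x Hx. eapply Mono; [|apply Hf].
    apply le_n_S. assert (Hm := le_n (list_max (map cA xs))).
    apply list_max_le in Hm. rewrite Forall_forall in Hm.
    apply Hm, in_map, Hx.
Qed.

(** * Scott's isomorphism theorem *)

Definition env {A} (d : A) (l : list A) : nat -> A := fun n => nth n l d.

Lemma scons_env {A} (d a : A) l : scons a (env d l) = env d (a :: l).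
Proof. apply functional_extensionality. intros [|n]; reflexivity. Qed.

(** If each of the countably many [b] failed some formula true of [a], the conjunction of these
    formulas would be satisfied by some element over [la] and by none over [lb]. *)
Lemma scott_extension {L} (M N : structure L) (dM : dom M) (dN : dom N) la lb (a : dom M) :
  countable_type (dom N) ->
  (forall psi, fbound L (length la) psi ->
    sat M (env dM la) psi -> sat N (env dN lb) psi) ->
  exists b, forall psi, fbound L (S (length la)) psi ->
    sat M (env dM (a :: la)) psi -> sat N (env dN (b :: lb)) psi.
Proof.
  intros CN H. apply NNPP. intros No.
  assert (W : forall b, exists psi, fbound L (S (length la)) psi /\
    sat M (env dM (a :: la)) psi /\ ~ sat N (env dN (b :: lb)) psi).
  { intros b. apply NNPP. intros Nb. apply No. exists b. intros psi B S.
    apply NNPP. intros NS. apply Nb. exists psi. auto. }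
  destruct (countable_nonempty_enum _ CN (inhabits dN)) as [enum Henum].
  destruct (choice _ (fun n => W (enum n))) as [psi Hpsi].
  destruct (H (Ex (BigAnd psi))) as [b Hb].
  - simpl. intros n. apply Hpsi.
  - exists a. simpl. intros n. rewrite scons_env. apply Hpsi.
  - destruct (Henum b) as [n <-]. apply (Hpsi n). rewrite <- scons_env. apply Hb.
Qed.

(** The finite conditions pair tuples that satisfy the same infinitary formulas. *)
Theorem scott_isomorphism {L} (M N : structure L) :
  countable_type (dom M) -> countable_type (dom N) ->
  (forall psi, sentence L psi -> models M psi -> models N psi) ->
  exists h : dom M -> dom N, isomorphism M N h.
Proof.
  intros CM CN H.
  destruct (dom_inhabited _ M) as [dM]. destruct (dom_inhabited _ N) as [dN].
  set (R := fun l : list (dom M * dom N) => forall psi, fbound L (length l) psi ->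
    (sat M (env dM (map fst l)) psi <-> sat N (env dN (map snd l)) psi)).
  (* Formulas are closed under negation, so an implication in one direction is already an
     equivalence. *)
  assert (Sym : forall (l : list (dom M * dom N)),
    (forall psi, fbound L (length l) psi ->
      sat M (env dM (map fst l)) psi -> sat N (env dN (map snd l)) psi) -> R l).
  { intros l Hl psi B. split; [apply Hl, B|]. intros S. apply NNPP. intros S'.
    exact (Hl (Neg psi) B S' S). }
  destruct (back_and_forth (dom M) (dom N) R CM CN) as [h [Hb Hh]].
  - apply Sym. intros psi B S. apply (H psi B). exact (models_of_sat _ _ _ B S).
  - intros l a Rl.
    destruct (scott_extension M N dM dN (map fst l) (map snd l) a CN) as [b Hb].
    { rewrite length_map. intros psi B. apply Rl, B. }
    exists b. apply Sym. intros psi B. apply Hb. rewrite length_map. exact B.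
  - intros l b Rl.
    destruct (scott_extension N M dN dM (map snd l) (map fst l) b CM) as [a Ha].
    { rewrite length_map. intros psi B. apply Rl, B. }
    exists a. apply Sym. intros psi B S. apply NNPP. intros S'.
    apply (Ha (Neg psi)); [rewrite length_map; exact B|exact S'|exact S].
  - intros l a b a' b' Rl I I'.
    apply In_nth with (d := (dM, dN)) in I, I'.
    destruct I as (i & Hi & Ei). destruct I' as (j & Hj & Ej).
    assert (E := Rl (Eq (Var i) (Var j))). simpl in E. unfold env in E.
    rewrite (map_nth fst l (dM, dN)), (map_nth fst l (dM, dN)) in E.
    rewrite (map_nth snd l (dM, dN)), (map_nth snd l (dM, dN)) in E.
    rewrite Ei, Ej in E. apply E. auto.
  (* [ix] gives the variables at which a condition stores the arguments of a symbol, so that its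
     atomic formula can be transferred. *)
  - assert (Idx : forall n (xs : arg n -> dom M) l,
      (forall i, In (xs i, h (xs i)) l) -> exists ix : arg n -> nat,
        (forall i, ix i < length l) /\ (forall i, env dM (map fst l) (ix i) = xs i) /\
        (forall i, env dN (map snd l) (ix i) = h (xs i))).
    { intros n xs l Hl.
      assert (J : forall i, exists k, k < length l /\
        env dM (map fst l) k = xs i /\ env dN (map snd l) k = h (xs i)).
      { intros i. destruct (In_nth _ _ (dM, dN) (Hl i)) as (k & Hk & E).
        exists k. split; [exact Hk|]. unfold env.
        rewrite (map_nth fst l (dM, dN)), (map_nth snd l (dM, dN)), E. auto. }
      destruct (choice _ J) as [ix Hix]. exists ix.
      repeat split; intros i; apply Hix. }
    exists h. split; [exact Hb|]. split.
    + intros f xs. destruct (arg_list _ _ xs) as [ls [Hls _]].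
      destruct (Hh (ifun M f xs :: ls)) as [l [Rl Il]].
      destruct (Idx _ xs l) as (ix & B & E1 & E2).
      { intros i. apply Il. right. apply Hls. }
      destruct (In_nth _ _ (dM, dN) (Il _ (or_introl eq_refl))) as (k & Hk & Ek).
      assert (E := proj1 (Rl (Eq (Var k) (Fun f (fun i => Var (ix i))))
        (conj Hk B))). simpl in E.
      replace (fun i => env dM (map fst l) (ix i)) with xs in E
        by (apply functional_extensionality; auto).
      replace (fun i => env dN (map snd l) (ix i)) with (fun i => h (xs i)) in E
        by (apply functional_extensionality; auto).
      unfold env in E.
      rewrite (map_nth fst l (dM, dN)), (map_nth snd l (dM, dN)), Ek in E. auto.
    + intros r xs. destruct (arg_list _ _ xs) as [ls [Hls _]].
      destruct (Hh ls) as [l [Rl Il]].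
      destruct (Idx _ xs l) as (ix & B & E1 & E2).
      { intros i. apply Il, Hls. }
      assert (E := Rl (Rel r (fun i => Var (ix i))) B). simpl in E.
      replace (fun i => env dM (map fst l) (ix i)) with xs in E
        by (apply functional_extensionality; auto).
      replace (fun i => env dN (map snd l) (ix i)) with (fun i => h (xs i)) in E
        by (apply functional_extensionality; auto).
      exact E.
Qed.

(** * Definability and the theory of coloured trees *)

(** The formula is uniform over all structures. Axioms can thus be stated as Rocq propositions and
    turned into one sentence by closure rules, without handling de Bruijn syntax. *)
Definition definable {L} (k : nat)
  (Q : forall M : structure L, (nat -> dom M) -> Prop) : Prop :=
  exists psi, fbound L k psi /\ forall M e, sat M e psi <-> Q M e.

Section Definability.
Context {L : lang}.
Implicit Types Q : forall M : structure L, (nat -> dom M) -> Prop.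

Lemma definable_ext k Q Q' :
  (forall M e, Q M e <-> Q' M e) -> definable k Q -> definable k Q'.
Proof.
  intros H [psi [B S]]. exists psi. split; [exact B|].
  intros M e. rewrite S. apply H.
Qed.

Lemma definable_not k Q : definable k Q -> definable k (fun M e => ~ Q M e).
Proof.
  intros [psi [B S]]. exists (Neg psi). split; [exact B|].
  intros M e. simpl. rewrite S. tauto.
Qed.

Lemma definable_all k (Q : forall M : structure L, dom M -> (nat -> dom M) -> Prop) :
  definable (S k) (fun M e => Q M (e 0) (fun n => e (S n))) ->
  definable k (fun M e => forall a, Q M a e).
Proof.
  intros [psi [B S]]. exists (Neg (Ex (Neg psi))). split; [exact B|].
  intros M e. simpl. split.
  - intros H a. apply (S M (scons a e)). apply NNPP. intros N. apply H. exists a. exact N.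
  - intros H [a N]. apply N, S, H.
Qed.

Lemma definable_ex k (Q : forall M : structure L, dom M -> (nat -> dom M) -> Prop) :
  definable (S k) (fun M e => Q M (e 0) (fun n => e (S n))) ->
  definable k (fun M e => exists a, Q M a e).
Proof.
  intros [psi [B S]]. exists (Ex psi). split; [exact B|].
  intros M e. simpl. split; intros [a H]; exists a; apply (S M (scons a e)), H.
Qed.

Lemma definable_const k (C : Prop) : definable k (fun (M : structure L) e => C).
Proof.
  assert (T : definable k (fun (M : structure L) e => True)).
  { exists (Neg (Ex (Neg (Eq (Var 0) (Var 0))))). split.
    - simpl. lia.
    - intros M e. simpl. split; [trivial|]. intros _ [a H]. auto. }
  destruct (classic C).
  - apply (definable_ext k _ _ (fun M e => conj (fun _ => H) (fun _ => I)) T).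
  - apply definable_not in T. refine (definable_ext k _ _ _ T). tauto.
Qed.

Lemma definable_forall k (J : Type) (Q : J -> forall M : structure L, (nat -> dom M) -> Prop) :
  countable_type J -> (forall j, definable k (Q j)) ->
  definable k (fun M e => forall j, Q j M e).
Proof.
  intros [c Hc] H.
  assert (H' : forall n, definable k (fun M e => forall j, c j = n -> Q j M e)).
  { intros n. destruct (classic (exists j, c j = n)) as [[j Hj]|N].
    - refine (definable_ext k _ _ _ (H j)). intros M e. split.
      + intros Hq j' Hj'. assert (j' = j) as -> by (apply Hc; congruence). exact Hq.
      + auto.
    - refine (definable_ext k _ _ _ (definable_const k True)). intros M e.
      split; [|trivial]. intros _ j Hj. exfalso. eauto. }
  destruct (choice _ H') as [psi Hpsi]. exists (BigAnd psi). split.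
  - intros n. apply Hpsi.
  - intros M e. simpl. split.
    + intros S j. exact (proj1 (proj2 (Hpsi (c j)) M e) (S (c j)) j eq_refl).
    + intros S n. apply Hpsi. auto.
Qed.

Lemma definable_exists k (J : Type) (Q : J -> forall M : structure L, (nat -> dom M) -> Prop) :
  countable_type J -> (forall j, definable k (Q j)) ->
  definable k (fun M e => exists j, Q j M e).
Proof.
  intros HJ H.
  refine (definable_ext k _ _ _ (definable_not _ _
    (definable_forall k J (fun j M e => ~ Q j M e) HJ (fun j => definable_not _ _ (H j))))).
  intros M e. split.
  - intros N. apply NNPP. intros N'. apply N. intros j Hj. apply N'. eauto.
  - intros [j Hj] N. exact (N j Hj).
Qed.

Lemma countable_bool : countable_type bool.
Proof. exists (fun b : bool => if b then 0 else 1). intros [] []; easy. Qed.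

Lemma definable_and k Q Q' :
  definable k Q -> definable k Q' -> definable k (fun M e => Q M e /\ Q' M e).
Proof.
  intros H H'.
  refine (definable_ext k _ _ _
    (definable_forall k bool (fun b => if b then Q else Q') countable_bool _)).
  - intros M e. split; [intros S; exact (conj (S true) (S false))|].
    intros [S S'] []; assumption.
  - intros []; assumption.
Qed.

Lemma definable_imp k Q Q' :
  definable k Q -> definable k Q' -> definable k (fun M e => Q M e -> Q' M e).
Proof.
  intros H H'.
  refine (definable_ext k _ _ _
    (definable_not _ _ (definable_and _ _ _ H (definable_not _ _ H')))).
  intros M e. tauto.
Qed.

Lemma definable_iff k Q Q' :
  definable k Q -> definable k Q' -> definable k (fun M e => Q M e <-> Q' M e).
Proof. intros H H'. apply definable_and; apply definable_imp; assumption. Qed.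

(** Axioms about function symbols and about finiteness quantify over tuples whose length is not a
    numeral; the tuple occupies the first [N] variables. *)
Lemma definable_all_args k N
  (Q : forall M : structure L, (arg N -> dom M) -> (nat -> dom M) -> Prop) :
  definable (N + k) (fun M e => Q M (fun i => e (proj1_sig i)) (fun n => e (N + n))) ->
  definable k (fun M e => forall xs, Q M xs e).
Proof.
  intros [psi [B S]].
  (* [alls] prefixes [N] universal quantifiers, and [app] is the environment once they have bound
     the first [N] variables to the values of [d]. *)
  set (alls := fix alls N (psi : formula L) := match N with
    | 0 => psi | S N => alls N (Neg (Ex (Neg psi))) end).
  set (app := fun (M : structure L) N (d e : nat -> dom M) n =>
    if lt_dec n N then d n else e (n - N)).
  assert (Ba : forall N psi, fbound L (N + k) psi -> fbound L k (alls N psi)).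
  { clear. induction N as [|N IH]; intros psi B; [exact B|].
    simpl. apply IH. exact B. }
  assert (Sa : forall M e N psi, sat M e (alls N psi) <->
    forall d, sat M (app M N d e) psi).
  { clear. intros M e. induction N as [|N IH]; intros psi.
    - assert (E : forall d, app M 0 d e = e).
      { intros d. apply functional_extensionality. intros n. unfold app. simpl.
        f_equal. lia. }
      simpl. split; [intros H d; rewrite E; exact H|].
      destruct (dom_inhabited _ M) as [d]. intros H. rewrite <- (E (fun _ => d)). apply H.
    - simpl. rewrite IH. clear IH. simpl.
      assert (E : forall d a, app M (S N) (scons a d) e = scons a (app M N d e)).
      { intros d a. apply functional_extensionality. intros [|n]; unfold app; simpl;
          [reflexivity|].
        destruct (lt_dec n N), (lt_dec (S n) (S N)); try lia; reflexivity. }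
      split.
      + intros H d. apply NNPP. intros Nd. apply (H (fun n => d (S n))).
        exists (d 0). rewrite <- E.
        replace (scons (d 0) (fun n => d (S n))) with d; [exact Nd|].
        apply functional_extensionality. intros [|n]; reflexivity.
      + intros H d [a Ha]. apply Ha. rewrite <- E. apply H. }
  exists (alls N psi). split; [apply Ba, B|].
  intros M e. rewrite Sa.
  assert (E : forall d, sat M (app M N d e) psi <-> Q M (fun i => d (proj1_sig i)) e).
  { intros d. rewrite S.
    replace (fun i : arg N => app M N d e (proj1_sig i))
      with (fun i : arg N => d (proj1_sig i)).
    2:{ apply functional_extensionality. intros [i Hi]. unfold app. simpl.
        destruct (lt_dec i N); [reflexivity|lia]. }
    replace (fun n => app M N d e (N + n)) with e; [tauto|].
    apply functional_extensionality. intros n. unfold app.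
    destruct (lt_dec (N + n) N); [lia|]. f_equal. lia. }
  split.
  - intros H xs.
    set (d := fun n => match lt_dec n N with left h => xs (exist _ n h) | right _ => e 0 end).
    replace xs with (fun i : arg N => d (proj1_sig i)); [apply E, H|].
    apply functional_extensionality. intros [i Hi]. unfold d. simpl.
    destruct (lt_dec i N) as [h|h]; [|tauto]. f_equal. f_equal. apply proof_irrelevance.
  - intros H d. apply E, H.
Qed.

Lemma definable_ex_args k N
  (Q : forall M : structure L, (arg N -> dom M) -> (nat -> dom M) -> Prop) :
  definable (N + k) (fun M e => Q M (fun i => e (proj1_sig i)) (fun n => e (N + n))) ->
  definable k (fun M e => exists xs, Q M xs e).
Proof.
  intros H.
  refine (definable_ext k _ _ _ (definable_not _ _
    (definable_all_args k N (fun M xs e => ~ Q M xs e) (definable_not _ _ H)))).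
  intros M e. split.
  - intros H'. apply NNPP. intros N'. apply H'. intros xs Hxs. eauto.
  - intros [xs Hxs] H'. exact (H' xs Hxs).
Qed.

Lemma definable_sentence Q :
  definable 0 Q -> definable 0 (fun M _ => forall e, Q M e).
Proof.
  intros [psi [B S]]. exists psi. split; [exact B|]. intros M e. split.
  - intros H e'. apply S. exact (sat_sentence M psi e e' B H).
  - intros H. apply S, H.
Qed.

Lemma definable_eq k i j : i < k -> j < k ->
  definable k (fun (M : structure L) e => e i = e j).
Proof. intros Hi Hj. exists (Eq (Var i) (Var j)). simpl. tauto. Qed.

Lemma definable_fun_eq k (f : fsym L) (ix : arg (far L f) -> nat) j :
  (forall i, ix i < k) -> j < k ->
  definable k (fun (M : structure L) e => ifun M f (fun i => e (ix i)) = e j).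
Proof.
  intros Hi Hj. exists (Eq (Fun f (fun i => Var (ix i))) (Var j)). simpl. tauto.
Qed.

Lemma definable_rel k (r : rsym L) (ix : arg (rar L r) -> nat) :
  (forall i, ix i < k) ->
  definable k (fun (M : structure L) e => irel M r (fun i => e (ix i))).
Proof. intros H. exists (Rel r (fun i => Var (ix i))). simpl. tauto. Qed.

End Definability.

Lemma least_arg n (Q : arg n -> Prop) : ~ (forall i, Q i) ->
  exists i, (forall j, proj1_sig j < proj1_sig i -> Q j) /\ ~ Q i.
Proof.
  intros H. apply not_all_ex_not in H. destruct H as [[i Hi] Ni].
  revert Hi Ni. induction i as [i IH] using lt_wf_ind. intros Hi Ni.
  destruct (classic (exists j : arg n, proj1_sig j < i /\ ~ Q j)) as [[[j Hj] [Lt Nj]]|No].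
  - apply (IH j Lt Hj Nj).
  - exists (exist _ i Hi). split; [|exact Ni]. intros j Hj.
    apply NNPP. intros Nj. apply No. exists j. auto.
Qed.

(** * The language and the axioms of coloured trees *)

Lemma countable_arg n : countable_type (arg n).
Proof. apply card_le_sig. Qed.

Lemma countable_nat : countable_type nat.
Proof. apply card_le_refl. Qed.

(** The sorts are [RU] (a model of the given sentence), [RP] (the homogeneous
    predicate) and the rest, whose elements [v] stand for sequences of finite subsets
    of [RU].  [RC v p] says that [v] has colour [p], and [RD n v w m] says that [v] and
    [w] agree below [n] and that [m] lies in the symmetric difference of their [n]-th
    entries; the entries themselves are not definable. *)
Inductive extra_rel := RU | RP | RC | RD (n : nat).

Definition extra_arity (r : extra_rel) : nat :=
  match r with RU | RP => 1 | RC => 2 | RD _ => 3 end.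

Lemma countable_rel_sum (L : lang) : countable_type (rsym L + extra_rel).
Proof.
  apply card_sum; [apply card_le_refl|apply rsym_countable|].
  exists (fun r => match r with RU => 0 | RP => 1 | RC => 2 | RD n => 3 + n end).
  intros [] [] E; simpl in E; congruence.
Qed.

Definition tree_lang (L : lang) : lang :=
  {| fsym := fsym L;
     far := far L;
     rsym := rsym L + extra_rel;
     rar := fun r => match r with inl r => rar L r | inr r => extra_arity r end;
     fsym_countable := fsym_countable L;
     rsym_countable := countable_rel_sum L |}.

Section Sorts.
Context {L : lang} (M : structure (tree_lang L)).

Definition isU (x : dom M) : Prop := irel M (inr RU : rsym (tree_lang L)) (fun _ => x).
Definition isP (x : dom M) : Prop := irel M (inr RP : rsym (tree_lang L)) (fun _ => x).
Definition isV (x : dom M) : Prop := ~ isU x /\ ~ isP x.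
Definition colour (v p : dom M) : Prop :=
  irel M (inr RC : rsym (tree_lang L))
    (fun i => match proj1_sig i with 0 => v | _ => p end).
Definition differ (n : nat) (v w m : dom M) : Prop :=
  irel M (inr (RD n) : rsym (tree_lang L))
    (fun i => match proj1_sig i with 0 => v | 1 => w | _ => m end).
(** [differ k] is also empty when [v] and [w] have split below [k]. Ranging over all levels below
    [n] is what makes this equality of the first [n] entries. *)
Definition agree (n : nat) (v w : dom M) : Prop :=
  forall k, k < n -> forall m, ~ differ k v w m.
End Sorts.

Fixpoint tr_term {L} (t : term L) : term (tree_lang L) :=
  match t with
  | Var n => Var n
  | Fun f ts => Fun (f : fsym (tree_lang L)) (fun i => tr_term (ts i))
  end.

(** Relativization of the quantifiers to [RU]. *)
Fixpoint tr {L} (phi : formula L) : formula (tree_lang L) :=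
  match phi with
  | Eq t u => Eq (tr_term t) (tr_term u)
  | Rel r ts => Rel (inl r : rsym (tree_lang L)) (fun i => tr_term (ts i))
  | Neg p => Neg (tr p)
  | BigAnd ps => BigAnd (fun n => tr (ps n))
  | Ex p => Ex (BigAnd (fun n => match n with
      | 0 => Rel (inr RU : rsym (tree_lang L)) (fun _ => Var 0)
      | _ => tr p end))
  end.

Lemma tr_fbound {L} (phi : formula L) : forall k,
  fbound L k phi -> fbound (tree_lang L) k (tr phi).
Proof.
  assert (T : forall k (t : term L), term_bound L k t ->
    term_bound (tree_lang L) k (tr_term t)).
  { intros k t. induction t as [n|f ts IH]; simpl; auto. }
  induction phi as [t u|r ts|p IH|ps IH|p IH]; intros k B; simpl in *; auto.
  - destruct B. auto.
  - intros [|n]; simpl; [lia|auto].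
Qed.

(** The classes of [agree n] are the nodes of level [n]. [tm_differ_xor] is the cocycle law for
    differences of children of a node, [tm_differ_finite] makes these differences finite subsets of
    [RU], and [tm_flip] realizes every singleton, hence every finite subset. Each of these clauses
    is expressible by countable conjunctions and disjunctions. *)
Record tree_model {L} (sigma : formula L) (M : structure (tree_lang L)) : Prop := {
  tm_disjoint : forall x, isU M x -> ~ isP M x;
  tm_rel : forall (r : rsym L) (xs : arg (rar L r) -> dom M),
    irel M (inl r : rsym (tree_lang L)) xs -> forall i, isU M (xs i);
  tm_fun : forall (f : fsym L) (xs : arg (far L f) -> dom M),
    (forall i, isU M (xs i)) -> isU M (ifun M (f : fsym (tree_lang L)) xs);
  (* On arguments not all in [RU], functions return the first one which is not. *)
  tm_junk : forall (f : fsym L) (i : arg (far L f)) (xs : arg (far L f) -> dom M),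
    (forall j : arg (far L f), proj1_sig j < proj1_sig i -> isU M (xs j)) ->
    ~ isU M (xs i) -> ifun M (f : fsym (tree_lang L)) xs = xs i;
  tm_U : exists x, isU M x;
  tm_sigma : forall e, sat M e (tr sigma);
  tm_colour_sorts : forall v p, colour M v p -> isV M v /\ isP M p;
  tm_colour_ex : forall v, isV M v -> exists p, colour M v p;
  tm_colour_unique : forall v p q, colour M v p -> colour M v q -> p = q;
  tm_differ_sorts : forall n v w m, differ M n v w m ->
    isV M v /\ isV M w /\ isU M m /\ agree M n v w;
  tm_differ_xor : forall n v w x m, isV M v -> isV M w -> isV M x ->
    agree M n v w -> agree M n w x ->
    (differ M n v x m <-> ~ (differ M n v w m <-> differ M n w x m));
  tm_differ_finite : forall n v w, exists N (xs : arg N -> dom M),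
    forall m, differ M n v w m -> exists i, m = xs i;
  tm_flip : forall n v m, isV M v -> isU M m ->
    exists w, isV M w /\ agree M n v w /\ forall m', differ M n v w m' <-> m' = m;
  tm_dense : forall n v p, isV M v -> isP M p -> exists w, colour M w p /\ agree M n v w;
  tm_separated : forall v w, isV M v -> isV M w ->
    (forall n m, ~ differ M n v w m) -> v = w;
  tm_V : exists v, isV M v;
  tm_P_infinite : forall N (xs : arg N -> dom M), exists p, isP M p /\ forall i, p <> xs i
}.

(** * Axiomatizing coloured trees by one sentence *)

Section TreeDefinability.
Context {L : lang}.

Lemma definable_isU k i : i < k ->
  definable k (fun (M : structure (tree_lang L)) e => isU M (e i)).
Proof. intros H. apply (definable_rel k (inr RU : rsym (tree_lang L))). auto. Qed.

Lemma definable_isU_fun k (f : fsym (tree_lang L)) (ix : arg (far L f) -> nat) :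
  (forall i, ix i < k) ->
  definable k (fun (M : structure (tree_lang L)) e => isU M (ifun M f (fun i => e (ix i)))).
Proof.
  intros H. exists (Rel (inr RU : rsym (tree_lang L)) (fun _ => Fun f (fun i => Var (ix i)))).
  split; [simpl; auto|]. intros M e. simpl. tauto.
Qed.

Lemma definable_isP k i : i < k ->
  definable k (fun (M : structure (tree_lang L)) e => isP M (e i)).
Proof. intros H. apply (definable_rel k (inr RP : rsym (tree_lang L))). auto. Qed.

Lemma definable_isV k i : i < k ->
  definable k (fun (M : structure (tree_lang L)) e => isV M (e i)).
Proof.
  intros H. apply definable_and; apply definable_not;
    [apply definable_isU|apply definable_isP]; exact H.
Qed.

Lemma definable_colour k i j : i < k -> j < k ->
  definable k (fun (M : structure (tree_lang L)) e => colour M (e i) (e j)).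
Proof.
  intros Hi Hj. refine (definable_ext k _ _ _ (definable_rel k (inr RC : rsym (tree_lang L))
    (fun a => match proj1_sig a with 0 => i | _ => j end) _)).
  - intros M e. unfold colour.
    replace (fun a : arg (rar (tree_lang L) (inr RC)) =>
        e match proj1_sig a with 0 => i | _ => j end)
      with (fun a : arg (rar (tree_lang L) (inr RC)) =>
        match proj1_sig a with 0 => e i | _ => e j end); [tauto|].
    apply functional_extensionality. intros [[|a] Ha]; reflexivity.
  - intros [[|a] Ha]; assumption.
Qed.

Lemma definable_differ k n i j l : i < k -> j < k -> l < k ->
  definable k (fun (M : structure (tree_lang L)) e => differ M n (e i) (e j) (e l)).
Proof.
  intros Hi Hj Hl.
  refine (definable_ext k _ _ _ (definable_rel k (inr (RD n) : rsym (tree_lang L))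
    (fun a => match proj1_sig a with 0 => i | 1 => j | _ => l end) _)).
  - intros M e. unfold differ.
    replace (fun a : arg (rar (tree_lang L) (inr (RD n))) =>
        e match proj1_sig a with 0 => i | 1 => j | _ => l end)
      with (fun a : arg (rar (tree_lang L) (inr (RD n))) =>
        match proj1_sig a with 0 => e i | 1 => e j | _ => e l end); [tauto|].
    apply functional_extensionality. intros [[|[|a]] Ha]; reflexivity.
  - intros [[|[|a]] Ha]; assumption.
Qed.

Lemma definable_agree k n i j : i < k -> j < k ->
  definable k (fun (M : structure (tree_lang L)) e => agree M n (e i) (e j)).
Proof.
  intros Hi Hj. apply definable_forall; [apply countable_nat|]. intros k'.
  apply definable_imp; [apply definable_const|].
  apply definable_all, definable_not, definable_differ; lia.
Qed.

End TreeDefinability.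

(** The rules for equivalence and negation precede those for conjunction and implication, to which
    they unfold. Goals about symbols of [L] are left open. *)
Ltac definability :=
  cbv beta;
  first
  [ apply definable_const
  | apply definable_isU; simpl; lia | apply definable_isP; simpl; lia
  | apply definable_isV; simpl; lia | apply definable_colour; simpl; lia
  | apply definable_differ; simpl; lia | apply definable_agree; simpl; lia
  | apply definable_eq; simpl; lia
  | apply definable_all; definability | apply definable_ex; definability
  | apply definable_all_args; definability | apply definable_ex_args; definability
  | apply definable_iff; definability
  | apply definable_not; definability
  | apply definable_and; definability
  | apply definable_imp; definability
  | apply definable_forall;
      [first [apply countable_nat | apply countable_arg | apply fsym_countable
             | apply rsym_countable] | intros ?; definability]
  | apply definable_exists;
      [first [apply countable_nat | apply countable_arg] | intros ?; definability]
  | idtac ].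

Ltac arg_lia :=
  repeat match goal with i : arg _ |- _ => destruct i end; simpl in *; lia.

Lemma tree_model_definable {L} (sigma : formula L) :
  sentence L sigma ->
  exists phi, sentence (tree_lang L) phi /\ forall M, models M phi <-> tree_model sigma M.
Proof.
  intros B.
  assert (D : definable 0 (fun (M : structure (tree_lang L)) _ => tree_model sigma M)).
  (* The type of [fields] is the conjunction of all axioms; it is read off as the property to
     define. *)
  { pose (fields := fun M (H : tree_model sigma M) =>
    conj (tm_disjoint _ _ H) (conj (tm_rel _ _ H) (conj (tm_fun _ _ H) (conj
    (tm_junk _ _ H) (conj (tm_U _ _ H) (conj (tm_sigma _ _ H) (conj
    (tm_colour_sorts _ _ H) (conj (tm_colour_ex _ _ H) (conj (tm_colour_unique _
    _ H) (conj (tm_differ_sorts _ _ H) (conj (tm_differ_xor _ _ H) (conj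
    (tm_differ_finite _ _ H) (conj (tm_flip _ _ H) (conj (tm_dense _ _ H) (conj
    (tm_separated _ _ H) (conj (tm_V _ _ H) (tm_P_infinite _ _ H))))))))))))))))).
    match type of fields with forall M, _ -> @?Q M =>
      apply (definable_ext 0 (fun M _ => Q M)) end.
    { intros M _. split; [|apply fields].
      intros (H1 & H2 & H3 & H4 & H5 & H6 & H7 & H8 & H9 & H10 & H11 & H12 & H13 &
                H14 & H15 & H16 & H17). constructor; assumption. }
    clear fields.
    repeat apply definable_and; definability.
    all: try (first [apply definable_isU | apply definable_eq]; arg_lia).
    - apply (definable_rel _ (inl _ : rsym (tree_lang L))). intros i. arg_lia.
    - apply definable_isU_fun. intros i. arg_lia.
    - apply (definable_fun_eq _ (_ : fsym (tree_lang L))); [intros i|]; arg_lia.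
    - apply definable_sentence. exists (tr sigma).
      split; [apply tr_fbound, B|]. tauto. }
  destruct D as [phi [Bphi S]]. exists phi. split; [exact Bphi|].
  intros M. split.
  - intros H. destruct (dom_inhabited _ M) as [d]. apply (S M (fun _ => d)), H.
  - intros H e. apply S, H.
Qed.

(** Any embedding onto [RU] is allowed, so that both the substructure on [RU] and the left summand
    of the full model are covered. *)
Lemma sat_tr {L} (X : structure L) (M : structure (tree_lang L)) (inc : dom X -> dom M) :
  injective inc -> (forall y, isU M y <-> exists x, inc x = y) ->
  (forall (f : fsym L) xs, inc (ifun X f xs) =
    ifun M (f : fsym (tree_lang L)) (fun i => inc (xs i))) ->
  (forall (r : rsym L) xs, irel X r xs <->
    irel M (inl r : rsym (tree_lang L)) (fun i => inc (xs i))) ->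
  forall phi e, sat X e phi <-> sat M (fun n => inc (e n)) (tr phi).
Proof.
  intros Hinj HU Hf Hr.
  assert (Ht : forall t e, inc (eval X e t) = eval M (fun n => inc (e n)) (tr_term t)).
  { induction t as [n|f ts IH]; intros e; [reflexivity|].
    simpl. rewrite Hf. f_equal. apply functional_extensionality. intros i. apply IH. }
  assert (Hs : forall a e, (fun n => inc (scons a e n)) = scons (inc a) (fun n => inc (e n))).
  { intros a e. apply functional_extensionality. intros [|n]; reflexivity. }
  induction phi as [t u|r ts|p IH|ps IH|p IH]; intros e; cbn [sat tr].
  - rewrite <- !Ht. split; [intros ->; reflexivity|apply Hinj].
  - rewrite Hr.
    assert (E : (fun i => eval M (fun n => inc (e n)) (tr_term (ts i))) =
                (fun i => inc (eval X e (ts i)))).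
    { apply functional_extensionality. intros i. symmetry. apply Ht. }
    enough (H : forall z : arg (rar L r) -> dom M, z = (fun i => inc (eval X e (ts i))) ->
      (irel M (inl r : rsym (tree_lang L)) (fun i : arg (rar L r) => inc (eval X e (ts i))) <->
       irel M (inl r : rsym (tree_lang L)) z)) by exact (H _ E).
    intros z ->. reflexivity.
  - rewrite IH. tauto.
  - split; intros H n; apply IH, H.
  - split.
    + intros [a Ha]. exists (inc a). intros [|n]; cbn [sat].
      * apply HU. exists a. reflexivity.
      * rewrite <- Hs. apply IH, Ha.
    + intros [y Ha]. destruct (proj1 (HU y) (Ha 0)) as [a <-].
      exists a. apply IH. rewrite Hs. exact (Ha 1).
Qed.

(** * The model of [sigma] inside a tree *)

Section UPart.
Context {L : lang} {sigma : formula L} {M : structure (tree_lang L)}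
  (HM : tree_model sigma M).

Lemma U_inhabited : inhabited {x | isU M x}.
Proof. destruct (tm_U _ _ HM) as [x Hx]. constructor. exists x. exact Hx. Qed.

Definition U_part : structure L :=
  {| dom := {x | isU M x};
     dom_inhabited := U_inhabited;
     ifun := fun (f : fsym L) xs => exist _ (ifun M (f : fsym (tree_lang L)) (fun i => proj1_sig (xs i)))
       (tm_fun _ _ HM f _ (fun i => proj2_sig (xs i)));
     irel := fun (r : rsym L) xs =>
       irel M (inl r : rsym (tree_lang L)) (fun i => proj1_sig (xs i)) |}.

Lemma U_part_models : models U_part sigma.
Proof.
  intros e. apply (sat_tr U_part M (@proj1_sig _ _)).
  - intros x y. apply sig_eq.
  - intros y. split; [|intros [x <-]; apply proj2_sig].
    intros H. exists (exist _ y H). reflexivity.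
  - reflexivity.
  - reflexivity.
  - apply (tm_sigma _ _ HM).
Qed.

End UPart.

(** * Back-and-forth between countable trees *)

Section TreeFacts.
Context {L : lang} {sigma : formula L} {M : structure (tree_lang L)}
  (HM : tree_model sigma M).

Lemma agree_le n k v w : k <= n -> agree M n v w -> agree M k v w.
Proof. intros H A j Hj. apply A. lia. Qed.

(** By the cocycle law for [v], [v], [v] the difference is its sum with itself modulo 2, hence
    empty. The induction supplies the agreement that the law presupposes. *)
Lemma differ_irrefl n v m : ~ differ M n v v m.
Proof.
  revert m. induction n as [n IH] using lt_wf_ind. intros m D.
  destruct (tm_differ_sorts _ _ HM _ _ _ _ D) as (V & _).
  assert (A : agree M n v v) by exact IH.
  apply (tm_differ_xor _ _ HM n v v v m V V V A A) in D. tauto.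
Qed.

Lemma agree_refl n v : agree M n v v.
Proof. intros k _ m. apply differ_irrefl. Qed.

Lemma differ_sym n v w m : differ M n v w m -> differ M n w v m.
Proof.
  revert v w m. induction n as [n IH] using lt_wf_ind. intros v w m D.
  destruct (tm_differ_sorts _ _ HM _ _ _ _ D) as (V & W & _ & A).
  assert (A' : agree M n w v).
  { intros k Hk m' D'. apply (A k Hk m'), IH; assumption. }
  assert (X := tm_differ_xor _ _ HM n v w v m V W V A A').
  assert (I := differ_irrefl n v m). tauto.
Qed.

Lemma agree_sym n v w : agree M n v w -> agree M n w v.
Proof. intros A k Hk m D. apply (A k Hk m), differ_sym, D. Qed.

Lemma agree_trans n v w x : isV M v -> isV M w -> isV M x ->
  agree M n v w -> agree M n w x -> agree M n v x.
Proof.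
  intros V W X A A' k Hk m D.
  assert (H := tm_differ_xor _ _ HM k v w x m V W X (agree_le n k _ _ (Nat.lt_le_incl _ _ Hk) A)
    (agree_le n k _ _ (Nat.lt_le_incl _ _ Hk) A')).
  assert (N := A k Hk m). assert (N' := A' k Hk m). tauto.
Qed.

(** The group action is transitive: elements of the finite set are flipped one at a time. *)
Lemma flip_list n v ms : isV M v -> (forall m, In m ms -> isU M m) ->
  exists w, isV M w /\ agree M n v w /\ forall m, differ M n v w m <-> In m ms.
Proof.
  intros V. induction ms as [|m0 ms IH]; intros H.
  - exists v. split; [exact V|]. split; [apply agree_refl|].
    intros m. assert (N := differ_irrefl n v m). simpl. tauto.
  - destruct IH as (w & W & A & D); [intros m Hm; apply H; right; exact Hm|].
    (* A repeated element is skipped, since a second flip would cancel the first. *)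
    destruct (classic (In m0 ms)) as [I|I].
    + exists w. split; [exact W|]. split; [exact A|]. intros m. rewrite D.
      simpl. split; [tauto|]. intros [<-|H']; assumption.
    + destruct (tm_flip _ _ HM n w m0 W (H m0 (or_introl eq_refl))) as (x & X & A' & D').
      exists x. split; [exact X|]. split; [apply (agree_trans n v w x); assumption|].
      intros m. rewrite (tm_differ_xor _ _ HM n v w x m V W X A A'), D, D'. simpl.
      split.
      * intros N. apply NNPP. intros N'. apply N. split; [tauto|].
        intros ->. tauto.
      * intros [<-|H']; [tauto|]. intros [Hm _]. apply I. rewrite <- (Hm H'). exact H'.
Qed.

(** Separation makes every element of the list split from [v] at some level; [w] is one whose level
    [n] is greatest. The others then constrain [v] only through [w]. *)
Lemma last_split v (ls : list (dom M)) : isV M v ->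
  (forall w, In w ls -> isV M w /\ w <> v) -> ls <> [] ->
  exists w n, In w ls /\ agree M n v w /\
    forall x, In x ls -> exists k m, k <= n /\ differ M k v x m.
Proof.
  intros V H NE. induction ls as [|x ls IH]; [congruence|].
  assert (S : exists n m, differ M n v x m).
  { apply NNPP. intros N. destruct (H x (or_introl eq_refl)) as [X Nx]. apply Nx.
    symmetry. apply (tm_separated _ _ HM v x V X). intros n m D. eauto. }
  destruct S as (n & m & D).
  assert (Ax := proj2 (proj2 (proj2 (tm_differ_sorts _ _ HM _ _ _ _ D)))).
  destruct ls as [|y ls].
  - exists x, n. split; [left; reflexivity|]. split; [exact Ax|].
    intros y [<-|[]]. exists n, m. auto.
  - destruct IH as (w & k & Iw & Aw & Hk);
      [intros z Hz; apply H; right; exact Hz|discriminate|].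
    destruct (le_lt_dec k n) as [Le|Lt].
    + exists x, n. split; [left; reflexivity|]. split; [exact Ax|].
      intros z [<-|Iz]; [exists n, m; auto|].
      destruct (Hk z Iz) as (j & m' & Hj & D'). exists j, m'. split; [lia|exact D'].
    + exists w, k. split; [right; exact Iw|]. split; [exact Aw|].
      intros z [<-|Iz]; [exists n, m; split; [lia|exact D]|apply Hk, Iz].
Qed.

Lemma differ_list n v w : exists ms,
  (forall m, In m ms -> isU M m) /\ forall m, differ M n v w m <-> In m ms.
Proof.
  destruct (tm_differ_finite _ _ HM n v w) as (N & xs & Hxs).
  destruct (arg_list _ _ xs) as [l [Hl _]].
  exists (filter (fun m => if excluded_middle_informative (differ M n v w m)
                           then true else false) l).
  assert (E : forall m, differ M n v w m <-> In m (filter (fun m =>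
    if excluded_middle_informative (differ M n v w m) then true else false) l)).
  { intros m. rewrite filter_In. destruct (excluded_middle_informative (differ M n v w m)).
    - split; [|tauto]. intros _. split; [|reflexivity].
      destruct (Hxs m) as [i ->]; [assumption|]. apply Hl.
    - split; [tauto|]. intros [_ F]. discriminate F. }
  split; [|exact E]. intros m Hm. apply E in Hm.
  apply (tm_differ_sorts _ _ HM _ _ _ _ Hm).
Qed.

Lemma P_avoid (l : list (dom M)) : exists p, isP M p /\ ~ In p l.
Proof.
  destruct (dom_inhabited _ M) as [d].
  destruct (tm_P_infinite _ _ HM (length l) (fun i => nth (proj1_sig i) l d)) as [p [Pp Hp]].
  exists p. split; [exact Pp|]. intros I.
  destruct (In_nth l p d I) as (i & Hi & E). apply (Hp (exist _ i Hi)). simpl. auto.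
Qed.

End TreeFacts.

(** An isomorphism of the [RU] parts and a bijection of the [RP] parts. As a relation it is inverted
    by swapping its arguments, which reduces the back step to the forth step. *)
Record matching {L} (M N : structure (tree_lang L)) (H : dom M -> dom N -> Prop) : Prop := {
  m_sort : forall a b, H a b -> (isU M a /\ isU N b) \/ (isP M a /\ isP N b);
  m_total : forall a, isU M a \/ isP M a -> exists b, H a b;
  m_onto : forall b, isU N b \/ isP N b -> exists a, H a b;
  m_inj : forall a b a' b', H a b -> H a' b' -> (a = a' <-> b = b');
  m_fun : forall (f : fsym L) (xs : arg (far L f) -> dom M) (ys : arg (far L f) -> dom N),
    (forall i, isU M (xs i)) -> (forall i, isU N (ys i)) -> (forall i, H (xs i) (ys i)) ->
    H (ifun M (f : fsym (tree_lang L)) xs) (ifun N (f : fsym (tree_lang L)) ys);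
  m_rel : forall (r : rsym L) (xs : arg (rar L r) -> dom M) (ys : arg (rar L r) -> dom N),
    (forall i, isU M (xs i)) -> (forall i, isU N (ys i)) -> (forall i, H (xs i) (ys i)) ->
    (irel M (inl r : rsym (tree_lang L)) xs <-> irel N (inl r : rsym (tree_lang L)) ys)
}.

Lemma matching_sym {L} (M N : structure (tree_lang L)) H :
  matching M N H -> matching N M (fun b a => H a b).
Proof.
  intros [H1 H2 H3 H4 H5 H6]. constructor; auto.
  - intros a b Hab. apply H1 in Hab. tauto.
  - intros a b a' b' Hab Hab'. symmetry. apply H4; assumption.
  - intros r xs ys Hx Hy Hxy. symmetry. apply H6; assumption.
Qed.

(** * Extending a matching to the sequences *)

Section Partial.
Context {L : lang} {sigma : formula L}.

(** On [RU] and [RP] the image is dictated by [H]; only sequences leave a choice, subject to their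
    colours. *)
Definition compatible (M N : structure (tree_lang L)) (H : dom M -> dom N -> Prop) a b : Prop :=
  H a b \/ (isV M a /\ isV N b /\ forall p q, colour M a p -> colour N b q -> H p q).

Definition partial_iso (M N : structure (tree_lang L)) (H : dom M -> dom N -> Prop)
  (l : list (dom M * dom N)) : Prop :=
  (forall a b, In (a, b) l -> compatible M N H a b) /\
  (forall a b a' b', In (a, b) l -> In (a', b') l ->
    isV M a -> isV N b -> isV M a' -> isV N b' ->
    forall n m m', H m m' -> (differ M n a a' m <-> differ N n b b' m')).

Definition swap {A B} (p : A * B) : B * A := (snd p, fst p).

Lemma In_swap (A B : Type) (l : list (A * B)) a b : In (b, a) (map swap l) <-> In (a, b) l.
Proof.
  rewrite in_map_iff. split.
  - intros [[a' b'] [E I]]. unfold swap in E. simpl in E. injection E as -> ->. exact I.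
  - intros I. exists (a, b). split; [reflexivity|exact I].
Qed.

Lemma partial_iso_sym (M N : structure (tree_lang L)) H l :
  partial_iso M N H l -> partial_iso N M (fun b a => H a b) (map swap l).
Proof.
  intros [H1 H2]. split.
  - intros b a I. apply (proj1 (In_swap _ _ _ _ _)) in I. destruct (H1 a b I) as [|(V & W & C)]; [left; auto|].
    right. auto.
  - intros b a b' a' I I' V W V' W' n m' m Hm. apply (proj1 (In_swap _ _ _ _ _)) in I, I'.
    symmetry. apply (H2 a b a' b'); assumption.
Qed.

(** For sequences this is separation: a difference of [b] and [b'] would correspond to a difference
    of [a] with itself. *)
Lemma partial_iso_eq (M N : structure (tree_lang L)) H l a b b' :
  tree_model sigma M -> tree_model sigma N -> matching M N H -> partial_iso M N H l ->
  In (a, b) l -> In (a, b') l -> b = b'.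
Proof.
  intros HM HN HH [H1 H2] I I'.
  destruct (H1 a b I) as [E|(V & W & _)], (H1 a b' I') as [E'|(V' & W' & _)].
  - apply (m_inj _ _ _ HH _ _ _ _ E E'). reflexivity.
  - exfalso. apply (m_sort _ _ _ HH) in E. destruct V'. tauto.
  - exfalso. apply (m_sort _ _ _ HH) in E'. destruct V. tauto.
  - apply (tm_separated _ _ HN b b' W W'). intros n m' D.
    destruct (m_onto _ _ _ HH m') as [m Hm].
    { left. apply (tm_differ_sorts _ _ HN _ _ _ _ D). }
    apply (H2 a b a b' I I' V W V' W' n m m' Hm) in D.
    exact (differ_irrefl HM n a m D).
Qed.

Lemma agree_matched (M N : structure (tree_lang L)) (H : dom M -> dom N -> Prop) n a a' b b' :
  tree_model sigma N -> matching M N H ->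
  (forall k, k < n -> forall m m', H m m' -> (differ M k a a' m <-> differ N k b b' m')) ->
  agree M n a a' -> agree N n b b'.
Proof.
  intros HN HH E A k Hk m' D.
  destruct (m_onto _ _ _ HH m') as [m Hm].
  { left. apply (tm_differ_sorts _ _ HN _ _ _ _ D). }
  apply (A k Hk m), (E k Hk m m' Hm), D.
Qed.

(* The image of v is found in the node determined by the element that splits last
   from v, at the prescribed difference, and then moved to the right colour above
   that node. *)
Lemma partial_iso_forth (M N : structure (tree_lang L)) H l a :
  tree_model sigma M -> tree_model sigma N -> matching M N H -> partial_iso M N H l ->
  exists b, partial_iso M N H ((a, b) :: l).
Proof.
  intros HM HN HH Hl. assert (HH' := matching_sym _ _ _ HH).
  destruct (classic (isU M a \/ isP M a)) as [UP|NUP].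
  { destruct (m_total _ _ _ HH a UP) as [b Hb]. exists b. split.
    - intros x y [E|I]; [injection E as <- <-; left; exact Hb|apply Hl, I].
    - intros x y x' y' [E|I] [E'|I'] V W V' W'.
      + injection E as <- <-. destruct V. tauto.
      + injection E as <- <-. destruct V. tauto.
      + injection E' as <- <-. destruct V'. tauto.
      + apply Hl; assumption. }
  assert (V : isV M a) by (split; tauto).
  (* [last_split] needs [a] distinct from the sequences in [l], so an old element keeps its
     image. *)
  destruct (classic (exists b, In (a, b) l)) as [[b Ib]|New].
  { exists b. split.
    - intros x y [E|I]; [injection E as <- <-; apply Hl, Ib|apply Hl, I].
    - intros x y x' y' [E|I] [E'|I']; try injection E as <- <-; try injection E' as <- <-;
        apply Hl; assumption. }
  destruct (tm_colour_ex _ _ HM a V) as [p Hp].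
  destruct (m_total _ _ _ HH p) as [q Hq].
  { right. apply (tm_colour_sorts _ _ HM _ _ Hp). }
  assert (Pq : isP N q).
  { destruct (m_sort _ _ _ HH _ _ Hq) as [[Up _]|[_ Pq]]; [|exact Pq].
    exfalso. apply (tm_disjoint _ _ HM p Up). apply (tm_colour_sorts _ _ HM _ _ Hp). }
  set (lV := filter (fun x => if excluded_middle_informative (isV M x) then true else false)
               (map fst l)).
  assert (HlV : forall x, In x lV <-> isV M x /\ exists y, In (x, y) l).
  { intros x. unfold lV. rewrite filter_In, in_map_iff.
    destruct (excluded_middle_informative (isV M x)) as [Vx|Vx].
    - split.
      + intros [[[x' y] [E I]] _]. simpl in E. subst x'. eauto.
      + intros [_ [y I]]. split; [|reflexivity]. exists (x, y). auto.
    - split; [intros [_ F]; discriminate F|tauto]. }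
  assert (Goal : exists b, colour N b q /\ forall x y, In (x, y) l -> isV M x -> isV N y ->
    forall n m m', H m m' -> (differ M n a x m <-> differ N n b y m')).
  { destruct lV as [|w0 lV0] eqn:ElV.
    (* With no sequence in [l] only the colour matters, and density at level 0 provides it. *)
    - destruct (tm_V _ _ HN) as [b0 V0].
      destruct (tm_dense _ _ HN 0 b0 q V0 Pq) as (b & Cb & _). exists b.
      split; [exact Cb|]. intros x y I Vx. exfalso. apply (HlV x). eauto.
    - destruct (last_split HM a (w0 :: lV0) V) as (w & n & Iw & Aw & Last).
      { intros x Hx. split; [apply HlV, Hx|]. intros ->. apply HlV in Hx. tauto. }
      { discriminate. }
      rewrite HlV in Iw. destruct Iw as [Vw [w' Iw]].
      assert (Vw' : isV N w').
      { destruct Hl as [Hl _]. destruct (Hl _ _ Iw) as [E|(_ & W & _)]; [|exact W].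
        exfalso. apply (m_sort _ _ _ HH) in E. destruct Vw. tauto. }
      (* The difference [ms] of [w] and [a] at the splitting level is carried by [H] to [ms'];
         flipping [ms'] from [w'] gives the node of the image. *)
      destruct (differ_list HM n w a) as (ms & Ums & Hms).
      assert (Hms' : exists ms', (forall m', In m' ms' -> isU N m') /\
        forall m m', H m m' -> (In m ms <-> In m' ms')).
      { clear Hms. induction ms as [|m ms IH].
        - exists []. simpl. tauto.
        - destruct IH as (ms' & U1 & U2); [intros m1 H1; apply Ums; right; exact H1|].
          assert (Um := Ums m (or_introl eq_refl)).
          destruct (m_total _ _ _ HH m (or_introl Um)) as [m' Hm]. exists (m' :: ms'). split.
          + intros m1 [<-|H1]; [|apply U1, H1].
            destruct (m_sort _ _ _ HH _ _ Hm) as [[_ Um']|[Pm _]]; [exact Um'|].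
            exfalso. exact (tm_disjoint _ _ HM m Um Pm).
          + intros m1 m1' H1. simpl. rewrite (U2 m1 m1' H1).
            rewrite (m_inj _ _ _ HH m m' m1 m1' Hm H1). tauto. }
      destruct Hms' as (ms' & Ums' & Hms').
      destruct (flip_list HN n w' ms' Vw' Ums') as (b0 & Vb0 & Ab0 & Db0).
      (* Density is used at [S n] rather than [n], so that recolouring preserves the difference just
         created at level [n]. *)
      destruct (tm_dense _ _ HN (S n) b0 q Vb0 Pq) as (b & Cb & Ab).
      assert (Vb := proj1 (tm_colour_sorts _ _ HN _ _ Cb)).
      exists b. split; [exact Cb|].
      assert (Ab' : agree N n w' b).
      { apply (agree_trans HN n w' b0 b); auto. apply (agree_le (S n)); [lia|exact Ab]. }
      assert (Db : forall m', differ N n w' b m' <-> In m' ms').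
      { intros m'. rewrite (tm_differ_xor _ _ HN n w' b0 b m' Vw' Vb0 Vb Ab0), Db0.
        - assert (N0 := Ab n (Nat.lt_succ_diag_r n) m'). tauto.
        - apply (agree_le (S n)); [lia|exact Ab]. }
      assert (Dw : forall k, k <= n -> forall m m', H m m' ->
        (differ M k a w m <-> differ N k b w' m')).
      { intros k Hk m m' Hm. destruct (Nat.eq_dec k n) as [->|Ne].
        - split; intros D.
          + apply (differ_sym HN). apply Db, (Hms' m m' Hm), Hms, (differ_sym HM), D.
          + apply (differ_sym HM). apply Hms, (Hms' m m' Hm), Db, (differ_sym HN), D.
        - split; intros D; exfalso.
          + apply (Aw k ltac:(lia) m D).
          + apply (Ab' k ltac:(lia) m'), (differ_sym HN), D. }
      intros x y I Vx Vy.
      (* Up to level [n] the comparison goes through [w]: if [w] and [x] agree below [k] the cocycle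
         law applies, otherwise [a] and [x] have split too and neither side differs at [k]. *)
      assert (Low : forall k, k <= n -> forall m m', H m m' ->
        (differ M k a x m <-> differ N k b y m')).
      { intros k Hk.
        assert (Awk : agree M k a w) by (apply (agree_le n); auto).
        assert (Abk : agree N k b w').
        { apply (agree_le n); [exact Hk|]. apply (agree_sym HN), Ab'. }
        assert (Dwx : forall j m m', H m m' -> (differ M j w x m <-> differ N j w' y m')).
        { intros j. destruct Hl as [_ Hl]. apply (Hl w w' x y); assumption. }
        destruct (classic (agree M k w x)) as [A|NA].
        - assert (A' : agree N k w' y).
          { apply (agree_matched M N H k w x); auto. }
          intros m m' Hm.
          rewrite (tm_differ_xor _ _ HM k a w x m V Vw Vx Awk A).
          rewrite (tm_differ_xor _ _ HN k b w' y m' Vb Vw' Vy Abk A').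
          rewrite (Dw k Hk m m' Hm), (Dwx k m m' Hm). tauto.
        - intros m m' Hm. split; intros D; exfalso; apply NA.
          + apply (agree_trans HM k w a x); auto; [apply (agree_sym HM), Awk|].
            apply (tm_differ_sorts _ _ HM _ _ _ _ D).
          + apply (agree_matched N M (fun b a => H a b) k w' y); auto.
            { intros j _ m1' m1 H1. symmetry. apply Dwx, H1. }
            apply (agree_trans HN k w' b y); auto; [apply (agree_sym HN), Abk|].
            apply (tm_differ_sorts _ _ HN _ _ _ _ D). }
      (* Above [n] both differences are empty: [a] and [x] have split by level [n], and by [Low] so
         have [b] and [y]. *)
      intros k m m' Hm. destruct (le_lt_dec k n) as [Le|Gt]; [apply Low; assumption|].
      destruct (Last x) as (j & mj & Hj & Dj); [apply HlV; eauto|].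
      destruct (m_total _ _ _ HH mj) as [mj' Hmj].
      { left. apply (tm_differ_sorts _ _ HM _ _ _ _ Dj). }
      split; intros D; exfalso.
      + apply (tm_differ_sorts _ _ HM) in D. destruct D as (_ & _ & _ & A).
        apply (A j ltac:(lia) mj Dj).
      + apply (tm_differ_sorts _ _ HN) in D. destruct D as (_ & _ & _ & A).
        apply (A j ltac:(lia) mj'), (Low j Hj mj mj' Hmj), Dj. }
  destruct Goal as (b & Cb & Db). exists b.
  assert (Vb := proj1 (tm_colour_sorts _ _ HN _ _ Cb)).
  split.
  - intros x y [E|I]; [|apply Hl, I]. injection E as <- <-. right.
    split; [exact V|]. split; [exact Vb|]. intros p' q' Hp' Hq'.
    rewrite <- (tm_colour_unique _ _ HM _ _ _ Hp Hp').
    rewrite <- (tm_colour_unique _ _ HN _ _ _ Cb Hq'). exact Hq.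
  - intros x y x' y' [E|I] [E'|I'] Vx Vy Vx' Vy' n m m' Hm.
    + injection E as <- <-. injection E' as <- <-.
      assert (I1 := differ_irrefl HM n a m). assert (I2 := differ_irrefl HN n b m'). tauto.
    + injection E as <- <-. apply Db; assumption.
    + injection E' as <- <-. assert (Dx := Db x y I Vx Vy n m m' Hm).
      split; intros D.
      * apply (differ_sym HN), Dx, (differ_sym HM), D.
      * apply (differ_sym HM), Dx, (differ_sym HN), D.
    + destruct Hl as [_ Hl]. apply (Hl x y x' y'); assumption.
Qed.

Lemma arg1_eta (A : Type) (xs : arg 1 -> A) :
  xs = fun _ => xs (exist _ 0 Nat.lt_0_1).
Proof.
  apply functional_extensionality. intros [i Hi].
  apply f_equal, sig_eq. simpl. lia.
Qed.

Lemma arg2_eta (A : Type) (xs : arg 2 -> A) : exists x y,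
  xs = fun i => match proj1_sig i with 0 => x | _ => y end.
Proof.
  exists (xs (exist (fun i => i < 2) 0 ltac:(cbv beta; lia))), (xs (exist (fun i => i < 2) 1 ltac:(cbv beta; lia))).
  apply functional_extensionality. intros [[|[|i]] Hi]; simpl;
    try (apply f_equal, sig_eq; reflexivity). lia.
Qed.

Lemma arg3_eta (A : Type) (xs : arg 3 -> A) : exists x y z,
  xs = fun i => match proj1_sig i with 0 => x | 1 => y | _ => z end.
Proof.
  exists (xs (exist (fun i => i < 3) 0 ltac:(cbv beta; lia))), (xs (exist (fun i => i < 3) 1 ltac:(cbv beta; lia))),
    (xs (exist (fun i => i < 3) 2 ltac:(cbv beta; lia))).
  apply functional_extensionality. intros [[|[|[|i]]] Hi]; simpl;
    try (apply f_equal, sig_eq; reflexivity). lia.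
Qed.

(** Sorts and colours are preserved by looking at one-element conditions, [RD] by conditions
    containing both sequences. Functions applied outside [RU] are preserved because the first
    argument outside [RU] is. *)
Theorem matching_extends (M N : structure (tree_lang L)) (H : dom M -> dom N -> Prop) :
  tree_model sigma M -> tree_model sigma N -> matching M N H ->
  countable_type (dom M) -> countable_type (dom N) ->
  exists h, isomorphism M N h /\ forall a b, H a b -> h a = b.
Proof.
  intros HM HN HH CM CN. assert (HH' := matching_sym _ _ _ HH).
  destruct (back_and_forth (dom M) (dom N) (partial_iso M N H) CM CN) as (h & Hb & Hh).
  - split; intros; contradiction.
  - intros l a Hl. apply partial_iso_forth; assumption.
  - intros l b Hl.
    destruct (partial_iso_forth N M (fun b a => H a b) (map swap l) b) as [a Ha]; auto.
    { apply partial_iso_sym, Hl. }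
    exists a. apply partial_iso_sym in Ha. simpl in Ha.
    rewrite map_map in Ha. replace (map _ l) with l in Ha; [exact Ha|].
    symmetry. erewrite map_ext; [apply map_id|]. intros []. reflexivity.
  - intros l a b a' b' Hl I I'. split.
    + intros <-. exact (partial_iso_eq M N H l a b b' HM HN HH Hl I I').
    + intros <-. apply partial_iso_sym in Hl. apply (proj2 (In_swap _ _ _ _ _)) in I, I'.
      apply (partial_iso_eq N M (fun b a => H a b) (map swap l) b a a'); assumption.
  - assert (Co : forall a, compatible M N H a (h a)).
    { intros a. destruct (Hh [a]) as [l [Hl I]]. apply Hl, I. left. reflexivity. }
    assert (hH : forall a b, H a b -> h a = b).
    { intros a b Hab. destruct (Co a) as [E|(V & _)].
      - apply (m_inj _ _ _ HH _ _ _ _ E Hab). reflexivity.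
      - exfalso. apply (m_sort _ _ _ HH) in Hab. destruct V. tauto. }
    assert (hU : forall a, isU M a <-> isU N (h a)).
    { intros a. assert (X := tm_disjoint _ _ HM a). assert (Y := tm_disjoint _ _ HN (h a)).
      destruct (Co a) as [E|([? ?] & [? ?] & _)]; [|tauto].
      apply (m_sort _ _ _ HH) in E. tauto. }
    assert (hP : forall a, isP M a <-> isP N (h a)).
    { intros a. assert (X := tm_disjoint _ _ HM a). assert (Y := tm_disjoint _ _ HN (h a)).
      destruct (Co a) as [E|([? ?] & [? ?] & _)]; [|tauto].
      apply (m_sort _ _ _ HH) in E. tauto. }
    assert (hUP : forall a, isU M a \/ isP M a -> H a (h a)).
    { intros a Ha. destruct (m_total _ _ _ HH a Ha) as [b Hab].
      rewrite (hH a b Hab). exact Hab. }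
    assert (hV : forall a, isV M a <-> isV N (h a)).
    { intros a. unfold isV. rewrite hU, hP. tauto. }
    exists h. split; [|exact hH]. split; [exact Hb|]. split.
    + intros f xs. destruct (classic (forall i, isU M (xs i))) as [U|NU].
      * apply hH. apply (m_fun _ _ _ HH); auto. intros i. apply hU, U.
      * destruct (least_arg _ _ NU) as (i & Hi & Ni).
        transitivity (h (xs i)); [f_equal; exact (tm_junk _ _ HM f i xs Hi Ni)|].
        symmetry. apply (tm_junk _ _ HN f i (fun i => h (xs i))).
        -- intros j Hj. apply hU, Hi, Hj.
        -- intros Ui. apply Ni, hU, Ui.
    + intros [r|[| | |n]] xs.
      * split; intros R.
        -- assert (U := tm_rel _ _ HM r xs R).
           apply (m_rel _ _ _ HH r xs (fun i => h (xs i))); auto.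
           intros i. apply hU, U.
        -- assert (U := tm_rel _ _ HN r _ R).
           assert (U' : forall i, isU M (xs i)) by (intros i; apply hU, U).
           apply (m_rel _ _ _ HH r xs (fun i => h (xs i))); auto.
      * simpl in xs. rewrite (arg1_eta _ xs). apply hU.
      * simpl in xs. rewrite (arg1_eta _ xs). apply hP.
      * simpl in xs. destruct (arg2_eta _ xs) as (v & p & ->).
        assert (E : (fun i : arg 2 => h match proj1_sig i with 0 => v | _ => p end) =
            (fun i => match proj1_sig i with 0 => h v | _ => h p end))
          by (apply functional_extensionality; intros [[|i] Hi]; reflexivity).
        change (colour M v p <-> irel N (inr RC : rsym (tree_lang L))
          (fun i : arg 2 => h match proj1_sig i with 0 => v | _ => p end)).
        rewrite E. clear E. change (colour M v p <-> colour N (h v) (h p)). split; intros C.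
        -- destruct (tm_colour_sorts _ _ HM _ _ C) as [Vv Pp].
           destruct (tm_colour_ex _ _ HN (h v)) as [q Hq]; [apply hV, Vv|].
           destruct (Co v) as [E|(_ & _ & Cv)].
           { exfalso. apply (m_sort _ _ _ HH) in E. destruct Vv. tauto. }
           rewrite (hH _ _ (Cv p q C Hq)). exact Hq.
        -- destruct (tm_colour_sorts _ _ HN _ _ C) as [Vv Pp].
           apply hV in Vv. apply hP in Pp.
           destruct (tm_colour_ex _ _ HM v Vv) as [p' Hp'].
           destruct (Co v) as [E|(_ & _ & Cv)].
           { exfalso. apply (m_sort _ _ _ HH) in E. destruct Vv. tauto. }
           assert (E := Cv p' (h p) Hp' C).
           rewrite <- (proj2 (m_inj _ _ _ HH _ _ _ _ E (hUP p (or_intror Pp))) eq_refl).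
           exact Hp'.
      * simpl in xs. destruct (arg3_eta _ xs) as (v & w & m & ->).
        assert (E : (fun i : arg 3 => h match proj1_sig i with 0 => v | 1 => w | _ => m end) =
            (fun i => match proj1_sig i with 0 => h v | 1 => h w | _ => h m end))
          by (apply functional_extensionality; intros [[|[|i]] Hi]; reflexivity).
        change (differ M n v w m <-> irel N (inr (RD n) : rsym (tree_lang L))
          (fun i : arg 3 => h match proj1_sig i with 0 => v | 1 => w | _ => m end)).
        rewrite E. clear E. change (differ M n v w m <-> differ N n (h v) (h w) (h m)).
        assert (K : isV M v -> isV M w -> isU M m ->
          (differ M n v w m <-> differ N n (h v) (h w) (h m))).
        { intros Vv Vw Um. destruct (Hh [v; w]) as (l & [_ Hl] & I).
          apply (Hl v (h v) w (h w)); try assumption.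
          - apply I. simpl. auto.
          - apply I. simpl. auto.
          - apply hV, Vv.
          - apply hV, Vw.
          - auto. }
        split; intros D.
        -- apply K; auto; apply (tm_differ_sorts _ _ HM _ _ _ _ D).
        -- destruct (tm_differ_sorts _ _ HN _ _ _ _ D) as (Vv & Vw & Um & _).
           apply hV in Vv, Vw. apply hU in Um. apply K; assumption.
Qed.

(** Beyond their disjointness, no clause of [matching] links [RU] with [RP], so the two bijections
    are chosen independently; complete homogeneity rests on this. *)
Lemma matching_of_bijections (M N : structure (tree_lang L))
  (HM : tree_model sigma M) (HN : tree_model sigma N)
  (h : dom (U_part HM) -> dom (U_part HN)) (s : {x | isP M x} -> {x | isP N x}) :
  isomorphism (U_part HM) (U_part HN) h -> bijective s ->
  matching M N (fun a b =>
    (exists x, proj1_sig x = a /\ proj1_sig (h x) = b) \/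
    (exists x, proj1_sig x = a /\ proj1_sig (s x) = b)).
Proof.
  intros [[h' [Eh Eh']] [Hf Hr]] [s' [Es Es']]. constructor.
  - intros a b [[x [<- <-]]|[x [<- <-]]]; [left|right]; split; apply proj2_sig.
  - intros a [U|P].
    + exists (proj1_sig (h (exist _ a U))). left. eexists. split; [|reflexivity]. reflexivity.
    + exists (proj1_sig (s (exist _ a P))). right. eexists. split; [|reflexivity]. reflexivity.
  - intros b [U|P].
    + exists (proj1_sig (h' (exist _ b U))). left. eexists. split; [reflexivity|].
      rewrite Eh'. reflexivity.
    + exists (proj1_sig (s' (exist _ b P))). right. eexists. split; [reflexivity|].
      rewrite Es'. reflexivity.
  - intros a b a' b' [[x [<- <-]]|[x [<- <-]]] [[y [<- <-]]|[y [<- <-]]].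
    + split; intros E; apply sig_eq in E.
      * congruence.
      * f_equal. rewrite <- (Eh x), E. apply Eh.
    + split; intros E; exfalso.
      * apply (tm_disjoint _ _ HM (proj1_sig x) (proj2_sig x)). rewrite E. apply proj2_sig.
      * apply (tm_disjoint _ _ HN (proj1_sig (h x)) (proj2_sig (h x))). rewrite E.
        apply proj2_sig.
    + split; intros E; exfalso.
      * apply (tm_disjoint _ _ HM (proj1_sig y) (proj2_sig y)). rewrite <- E. apply proj2_sig.
      * apply (tm_disjoint _ _ HN (proj1_sig (h y)) (proj2_sig (h y))). rewrite <- E.
        apply proj2_sig.
    + split; intros E; apply sig_eq in E.
      * congruence.
      * f_equal. rewrite <- (Es x), E. apply Es.
  - intros f xs ys Ux Uy Hxy. left.
    assert (E : forall i, proj1_sig (h (exist _ (xs i) (Ux i))) = ys i).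
    { intros i. destruct (Hxy i) as [[x [E1 E2]]|[x [E1 _]]].
      - rewrite <- E2. f_equal. f_equal. apply sig_eq. symmetry. exact E1.
      - exfalso. apply (tm_disjoint _ _ HM _ (Ux i)). rewrite <- E1. apply proj2_sig. }
    exists (ifun (U_part HM) f (fun i => exist _ (xs i) (Ux i))). split; [reflexivity|].
    rewrite Hf. simpl. f_equal. apply functional_extensionality. exact E.
  - intros r xs ys Ux Uy Hxy.
    assert (E : (fun i => proj1_sig (h (exist _ (xs i) (Ux i)))) = ys).
    { apply functional_extensionality. intros i. destruct (Hxy i) as [[x [E1 E2]]|[x [E1 _]]].
      - rewrite <- E2. f_equal. f_equal. apply sig_eq. symmetry. exact E1.
      - exfalso. apply (tm_disjoint _ _ HM _ (Ux i)). rewrite <- E1. apply proj2_sig. }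
    subst ys. exact (Hr r (fun i => exist _ (xs i) (Ux i))).
Qed.

End Partial.

(** * Uniqueness and homogeneity of the countable tree *)

Section CountableIso.
Context {L : lang} {sigma : formula L}.

(** Both parts are countable and infinite, so back-and-forth succeeds with injectivity as the sole
    condition. *)
Lemma P_bijection (M N : structure (tree_lang L)) :
  tree_model sigma M -> tree_model sigma N ->
  countable_type (dom M) -> countable_type (dom N) ->
  exists s : {x | isP M x} -> {x | isP N x}, bijective s.
Proof.
  intros HM HN CM CN.
  destruct (back_and_forth {x | isP M x} {x | isP N x}
    (fun l => forall a b a' b', In (a, b) l -> In (a', b') l -> (a = a' <-> b = b')))
    as (s & Hs & _).
  - eapply card_le_trans; [apply card_le_sig|exact CM].
  - eapply card_le_trans; [apply card_le_sig|exact CN].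
  - intros a b a' b' [].
  - intros l a Hl. destruct (classic (exists b, In (a, b) l)) as [[b Ib]|New].
    + exists b. intros x y x' y' [E|I] [E'|I'];
        try injection E as <- <-; try injection E' as <- <-; auto; tauto.
    + destruct (P_avoid HN (map (fun p => proj1_sig (snd p)) l)) as [b [Pb Nb]].
      exists (exist _ b Pb).
      assert (Nb' : forall x, ~ In (x, exist _ b Pb) l).
      { intros x I. apply Nb. apply in_map_iff. eexists. split; [|exact I]. reflexivity. }
      intros x y x' y' [E|I] [E'|I'];
        try injection E as <- <-; try injection E' as <- <-; auto; [tauto| |];
        split; intros Ex; subst; exfalso; first [eapply Nb'; eassumption | eauto].
  - intros l b Hl. destruct (classic (exists a, In (a, b) l)) as [[a Ia]|New].
    + exists a. intros x y x' y' [E|I] [E'|I'];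
        try injection E as <- <-; try injection E' as <- <-; auto; tauto.
    + destruct (P_avoid HM (map (fun p => proj1_sig (fst p)) l)) as [a [Pa Na]].
      exists (exist _ a Pa).
      assert (Na' : forall y, ~ In (exist _ a Pa, y) l).
      { intros x I. apply Na. apply in_map_iff. eexists. split; [|exact I]. reflexivity. }
      intros x y x' y' [E|I] [E'|I'];
        try injection E as <- <-; try injection E' as <- <-; auto; [tauto| |];
        split; intros Ex; subst; exfalso; first [eapply Na'; eassumption | eauto].
  - intros l a b a' b' Hl. apply Hl.
  - exists s. exact Hs.
Qed.

Lemma complete_transfer (M N : structure L) psi :
  complete_sentence sigma -> models M sigma -> models N sigma ->
  sentence L psi -> models M psi -> models N psi.
Proof.
  intros [_ C] HM HN B S e. destruct (C psi B) as [V|V].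
  - exact (proj1 (sat_Impl _ _ _ _) (V N e) (HN e)).
  - exfalso. destruct (dom_inhabited _ M) as [d].
    exact (proj1 (sat_Impl _ _ _ _) (V M (fun _ => d)) (HM _) (S _)).
Qed.

(** Completeness of [sigma] enters through Scott's theorem, which makes the countable [RU] parts
    isomorphic. *)
Theorem countable_tree_models_isomorphic (M N : structure (tree_lang L)) :
  complete_sentence sigma -> tree_model sigma M -> tree_model sigma N ->
  countable_type (dom M) -> countable_type (dom N) ->
  exists h, isomorphism M N h.
Proof.
  intros C HM HN CM CN.
  destruct (scott_isomorphism (U_part HM) (U_part HN)) as [h Hh].
  - eapply card_le_trans; [apply card_le_sig|exact CM].
  - eapply card_le_trans; [apply card_le_sig|exact CN].
  - intros psi. apply (complete_transfer _ _ psi C); apply U_part_models.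
  - destruct (P_bijection M N HM HN CM CN) as [s Hs].
    destruct (matching_extends M N _ HM HN (matching_of_bijections M N HM HN h s Hh Hs) CM CN)
      as [g [Hg _]].
    exists g. exact Hg.
Qed.

(** The given permutation of [RP] is matched together with the identity on [RU]. *)
Lemma tree_model_homogeneous (M : structure (tree_lang L)) :
  tree_model sigma M -> countable_type (dom M) ->
  completely_homogeneous (inr RP : rsym (tree_lang L)) M.
Proof.
  intros HM CM. split.
  - assert (S : forall l : list {x | isP M x}, exists p, ~ In p l).
    { intros l. destruct (P_avoid HM (map (@proj1_sig _ _) l)) as [p [Pp Np]].
      exists (exist _ p Pp). intros I. apply Np, in_map_iff. eexists.
      split; [|exact I]. reflexivity. }
    destruct (choice _ S) as [next Hnext].
    set (chain := fix chain n := match n with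
      | 0 => [] | S n => next (chain n) :: chain n end).
    assert (Mono : forall n m, n < m -> In (next (chain n)) (chain m)).
    { intros n m H. induction H; simpl; auto. }
    exists (fun n => next (chain n)). intros n m E.
    destruct (lt_eq_lt_dec n m) as [[Lt|Eq]|Gt]; [exfalso|exact Eq|exfalso].
    + apply (Hnext (chain m)). rewrite <- E. auto.
    + apply (Hnext (chain n)). rewrite E. auto.
  - intros s Hs.
    assert (Id : isomorphism (U_part HM) (U_part HM) (fun x => x)).
    { split; [exists (fun x => x); split; reflexivity|]. split; [reflexivity|tauto]. }
    destruct (matching_extends M M _ HM HM (matching_of_bijections M M HM HM _ s Id Hs) CM CM)
      as [g [Hg Eg]].
    exists g. split; [exact Hg|]. intros x. apply Eg. right. eauto.
Qed.

End CountableIso.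

(** * Cardinality of trees *)

(* [v] is recovered from its difference, at each level [n], with a fixed
   representative of the class of [v] for agreement below [n]. *)
Lemma tree_model_card {L} (sigma : formula L) (M : structure (tree_lang L)) (K : Type) :
  infinite_type K -> tree_model sigma M -> card_le {x | isU M x} K ->
  card_le (dom M) (nat -> K).
Proof.
  intros HK HM HU.
  assert (KK : card_le K (nat -> K)).
  { exists (fun k _ => k). intros x y E. exact (f_equal (fun g => g 0) E). }
  assert (HKK : infinite_type (nat -> K)) by (eapply infinite_of_card_le; eassumption).
  destruct (tm_V _ _ HM) as [v0 V0].
  assert (HV : card_le {x | isV M x} (nat -> K)).
  { assert (HL : card_le (list {x | isU M x}) K).
    { eapply card_le_trans; [apply card_le_list, HU|apply card_list, HK]. }
    destruct HL as [code Hcode].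
    (* [epsilon] depends on the predicate alone, so sequences that agree below [n] receive the same
       representative. *)
    set (rep := fun n v => epsilon (inhabits v0) (fun w => isV M w /\ agree M n v w)).
    assert (Hrep : forall n v, isV M v -> isV M (rep n v) /\ agree M n v (rep n v)).
    { intros n v V. apply epsilon_spec. exists v. split; [exact V|apply (agree_refl HM)]. }
    assert (Erep : forall n v w, isV M v -> isV M w -> agree M n v w -> rep n v = rep n w).
    { intros n v w V W A. unfold rep. f_equal. apply functional_extensionality. intros x.
      apply propositional_extensionality. split; intros [X A']; split; auto.
      - apply (agree_trans HM n w v x); auto. apply (agree_sym HM), A.
      - apply (agree_trans HM n v w x); auto. }
    assert (D : forall p : nat * {x | isV M x}, exists ms : list {x | isU M x}, forall m,
      differ M (fst p) (rep (fst p) (proj1_sig (snd p))) (proj1_sig (snd p)) m <->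
      In m (map (@proj1_sig _ _) ms)).
    { intros [n [v V]]. simpl. destruct (differ_list HM n (rep n v) v) as (ms & U & E).
      assert (E' : exists ms' : list {x | isU M x}, ms = map (@proj1_sig _ _) ms').
      { clear E. induction ms as [|m ms IH]; [exists []; reflexivity|].
        destruct IH as [ms' ->]; [intros x Hx; apply U; right; exact Hx|].
        exists (exist _ m (U m (or_introl eq_refl)) :: ms'). reflexivity. }
      destruct E' as [ms' ->]. eauto. }
    destruct (choice _ D) as [diff Hdiff].
    exists (fun v n => code (diff (n, v))). intros [v V] [w W] E. apply sig_eq. simpl.
    (* Once [v] and [w] agree below [n] they share a representative, and the cocycle law through it
       turns equal codes at [n] into an empty difference. *)
    apply (tm_separated _ _ HM v w V W). intros n. induction n as [n IH] using lt_wf_ind.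
    intros m D'. assert (A : agree M n v w) by exact IH.
    assert (E1 : diff (n, exist _ v V) = diff (n, exist _ w W))
      by (apply Hcode; exact (f_equal (fun g => g n) E)).
    destruct (Hrep n v V) as [R Av]. destruct (Hrep n w W) as [_ Aw].
    assert (H1 := Hdiff (n, exist _ v V) m). assert (H2 := Hdiff (n, exist _ w W) m).
    rewrite E1 in H1. simpl in H1, H2. rewrite <- (Erep n v w V W A) in H2, Aw.
    rewrite (tm_differ_xor _ _ HM n v (rep n v) w m V R W Av (agree_sym HM _ _ _ Aw)) in D'.
    apply D'. rewrite H2, <- H1. split; apply (differ_sym HM). }
  (* By density every colour is used, so choosing a sequence of each colour injects [RP] into the
     sequences. *)
  assert (HP : card_le {x | isP M x} {x | isV M x}).
  { assert (C : forall p : {x | isP M x}, exists v : {x | isV M x},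
      colour M (proj1_sig v) (proj1_sig p)).
    { intros [p P]. destruct (tm_dense _ _ HM 0 v0 p V0 P) as (v & C & _).
      exists (exist _ v (proj1 (tm_colour_sorts _ _ HM _ _ C))). exact C. }
    destruct (choice _ C) as [f Hf]. exists f. intros p q E. apply sig_eq.
    apply (tm_colour_unique _ _ HM (proj1_sig (f p))); [apply Hf|]. rewrite E. apply Hf. }
  apply card_le_trans with ({x | isU M x} + ({x | isV M x} + {x | isP M x}))%type.
  - apply (card_le_of_surjection _ _ (fun s => match s with
      | inl x => proj1_sig x | inr (inl x) => proj1_sig x | inr (inr x) => proj1_sig x end)).
    intros x. destruct (classic (isU M x)) as [U|NU]; [exists (inl (exist _ x U)); reflexivity|].
    destruct (classic (isP M x)) as [P|NP].
    + exists (inr (inr (exist _ x P))). reflexivity.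
    + exists (inr (inl (exist _ x (conj NU NP)))). reflexivity.
  - apply card_sum; [exact HKK|eapply card_le_trans; eassumption|].
    apply card_sum; [exact HKK|exact HV|eapply card_le_trans; eassumption].
Qed.

Lemma fresh_value (T : Type) (j : nat -> T) (l : list T) :
  injective j -> exists n, ~ In (j n) l.
Proof.
  intros Hj. apply NNPP. intros N.
  assert (I : incl (map j (seq 0 (S (length l)))) l).
  { intros x Hx. apply in_map_iff in Hx. destruct Hx as [n [<- _]].
    apply NNPP. eauto. }
  apply NoDup_incl_length in I; [rewrite length_map, length_seq in I; lia|].
  apply FinFun.Injective_map_NoDup; [exact Hj|apply seq_NoDup].
Qed.

(** * The tree of all sequences of finite subsets *)

Section FullModel.
Context {L : lang} (X : structure L).

(** Characteristic functions make equality of sequences extensional and turn symmetric difference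
    into inequality of values. *)
Definition locally_finite (v : nat -> dom X -> bool) : Prop :=
  forall n, exists l, forall m, v n m = true -> In m l.

Definition fvec : Type := {v : nat -> dom X -> bool | locally_finite v}.
Definition fdom : Type := (dom X + (fvec + (nat -> dom X)))%type.

(** The sequence [g] is written in [v], as singletons, after an empty entry. *)
Definition decodes (v : nat -> dom X -> bool) (g : nat -> dom X) : Prop :=
  exists n, (forall m, v n m = false) /\ forall k m, v (S n + k) m = true <-> m = g k.

(** All entries after the marker are singletons, so the marker is the last empty entry and its
    position is determined. *)
Lemma decodes_unique v g g' : decodes v g -> decodes v g' -> g = g'.
Proof.
  intros [n [Z H]] [n' [Z' H']].
  destruct (lt_eq_lt_dec n n') as [[Lt| ->]|Lt].
  - exfalso. assert (T := proj2 (H (n' - S n) (g (n' - S n))) eq_refl).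
    replace (S n + (n' - S n)) with n' in T by lia. rewrite Z' in T. discriminate.
  - apply functional_extensionality. intros k. apply H', H. reflexivity.
  - exfalso. assert (T := proj2 (H' (n - S n') (g' (n - S n'))) eq_refl).
    replace (S n' + (n - S n')) with n in T by lia. rewrite Z in T. discriminate.
Qed.

Lemma decoding_exists : exists col : fvec -> nat -> dom X,
  forall v g, decodes (proj1_sig v) g -> col v = g.
Proof.
  destruct (dom_inhabited _ X) as [d].
  apply (choice (fun (v : fvec) h => forall g, decodes (proj1_sig v) g -> h = g)).
  intros v. destruct (classic (exists g, decodes (proj1_sig v) g)) as [[g Hg]|N].
  - exists g. intros g'. apply decodes_unique, Hg.
  (* A sequence that writes nothing gets an arbitrary colour; density only uses those that do write
     one. *)
  - exists (fun _ => d). intros g Hg. exfalso. eauto.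
Qed.

Definition fcol : fvec -> nat -> dom X :=
  proj1_sig (constructive_indefinite_description _ decoding_exists).

Lemma fcol_decodes v g : decodes (proj1_sig v) g -> fcol v = g.
Proof.
  apply (proj2_sig (constructive_indefinite_description _ decoding_exists)).
Qed.

Definition in_U (x : fdom) : Prop := exists z, x = inl z.

Definition extends_fun (f : fsym L) (xs : arg (far L f) -> fdom) (y : fdom) : Prop :=
  (forall zs, xs = (fun i => inl (zs i)) -> y = inl (ifun X f zs)) /\
  (forall i, (forall j, proj1_sig j < proj1_sig i -> in_U (xs j)) -> ~ in_U (xs i) ->
    y = xs i).

Lemma extends_fun_ex f xs : exists y, extends_fun f xs y.
Proof.
  destruct (classic (forall i, in_U (xs i))) as [U|NU].
  - destruct (choice _ U) as [zs Hzs]. exists (inl (ifun X f zs)). split.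
    + intros zs' E. do 2 f_equal. apply functional_extensionality. intros i.
      specialize (Hzs i). rewrite E in Hzs. congruence.
    + intros i _ N. exfalso. auto.
  - destruct (least_arg _ _ NU) as (i & Hi & Ni). exists (xs i). split.
    + intros zs E. exfalso. apply Ni. exists (zs i). rewrite E. reflexivity.
    + intros i' Hi' Ni'. destruct (lt_eq_lt_dec (proj1_sig i) (proj1_sig i')) as [[Lt|E]|Lt].
      * exfalso. auto.
      * f_equal. apply sig_eq, E.
      * exfalso. auto.
Qed.

(** Arguments are read at explicit indices, so that the characterizations of sorts, colours and
    differences below hold by conversion. *)
Definition full_rel (r : rsym (tree_lang L)) : (arg (rar (tree_lang L) r) -> fdom) -> Prop :=
  match r return (arg (rar (tree_lang L) r) -> fdom) -> Prop with
  | inl r => fun xs => exists zs, xs = (fun i => inl (zs i)) /\ irel X r zs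
  | inr RU => fun xs => in_U (xs (exist (fun i => i < 1) 0 (le_n 1)))
  | inr RP => fun xs => exists g, xs (exist (fun i => i < 1) 0 (le_n 1)) = inr (inr g)
  | inr RC => fun xs => exists v,
      xs (exist (fun i => i < 2) 0 (le_S _ _ (le_n 1))) = inr (inl v) /\
      xs (exist (fun i => i < 2) 1 (le_n 2)) = inr (inr (fcol v))
  | inr (RD n) => fun xs => exists v w m,
      xs (exist (fun i => i < 3) 0 (le_S _ _ (le_S _ _ (le_n 1)))) = inr (inl v) /\
      xs (exist (fun i => i < 3) 1 (le_S _ _ (le_n 2))) = inr (inl w) /\
      xs (exist (fun i => i < 3) 2 (le_n 3)) = inl m /\
      (forall k m', k < n -> proj1_sig v k m' = proj1_sig w k m') /\
      proj1_sig v n m <> proj1_sig w n m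
  end.

Definition full_model : structure (tree_lang L) :=
  {| dom := fdom;
     dom_inhabited := match dom_inhabited _ X with inhabits x => inhabits (inl x) end;
     ifun := fun (f : fsym (tree_lang L)) xs =>
       proj1_sig (constructive_indefinite_description _ (extends_fun_ex f xs));
     irel := full_rel |}.

Lemma full_fun (f : fsym L) xs :
  extends_fun f xs (ifun full_model (f : fsym (tree_lang L)) xs).
Proof. apply (proj2_sig (constructive_indefinite_description _ (extends_fun_ex f xs))). Qed.

Lemma full_isU x : isU full_model x <-> in_U x.
Proof. reflexivity. Qed.

Lemma full_isP x : isP full_model x <-> exists g, x = inr (inr g).
Proof. reflexivity. Qed.

Lemma full_isV x : isV full_model x <-> exists v, x = inr (inl v).
Proof.
  unfold isV. rewrite full_isU, full_isP. split.
  - intros [N N']. destruct x as [z|[v|g]]; [|eauto|]; exfalso.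
    + apply N. exists z. reflexivity.
    + eauto.
  - intros [v ->]. split; intros [z E]; discriminate.
Qed.

Lemma full_colour x y : colour full_model x y <->
  exists v, x = inr (inl v) /\ y = inr (inr (fcol v)).
Proof. reflexivity. Qed.

Lemma full_differ n x y z : differ full_model n x y z <->
  exists v w m, x = inr (inl v) /\ y = inr (inl w) /\ z = inl m /\
    (forall k m', k < n -> proj1_sig v k m' = proj1_sig w k m') /\
    proj1_sig v n m <> proj1_sig w n m.
Proof. reflexivity. Qed.

Lemma full_differ_vec n (v w : fvec) m :
  differ full_model n (inr (inl v)) (inr (inl w)) (inl m) <->
  (forall k m', k < n -> proj1_sig v k m' = proj1_sig w k m') /\
  proj1_sig v n m <> proj1_sig w n m.
Proof.
  rewrite full_differ. split.
  - intros (v' & w' & m' & E1 & E2 & E3 & H).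
    injection E1 as <-. injection E2 as <-. injection E3 as <-. exact H.
  - intros H. exists v, w, m. auto.
Qed.

(** [RD] sees a difference only at the first level where the sequences split, hence the strong
    induction. *)
Lemma full_agree n (v w : fvec) : agree full_model n (inr (inl v)) (inr (inl w)) <->
  forall k m, k < n -> proj1_sig v k m = proj1_sig w k m.
Proof.
  split.
  - intros A k. induction k as [k IH] using lt_wf_ind. intros m Hk.
    apply NNPP. intros N. apply (A k Hk (inl m)), full_differ_vec.
    split; [|exact N]. intros k' m' Hk'. apply IH; [exact Hk'|lia].
  - intros H k Hk z D. apply (proj1 (full_differ _ _ _ _)) in D.
    destruct D as (v' & w' & m & E1 & E2 & _ & _ & N).
    injection E1 as <-. injection E2 as <-. apply N, H, Hk.
Qed.

Lemma full_differ_list n x y : exists l, forall z, differ full_model n x y z -> In z l.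
Proof.
  destruct (classic (isV full_model x /\ isV full_model y)) as [[Vx Vy]|N].
  - apply full_isV in Vx, Vy. destruct Vx as [v ->], Vy as [w ->].
    destruct (proj2_sig v n) as [l Hl]. destruct (proj2_sig w n) as [l' Hl'].
    exists (map inl (l ++ l')). intros z D. apply (proj1 (full_differ _ _ _ _)) in D.
    destruct D as (v' & w' & m & E1 & E2 & -> & _ & Ne).
    injection E1 as <-. injection E2 as <-. apply in_map, in_or_app.
    destruct (proj1_sig v n m) eqn:E; [left; auto|].
    destruct (proj1_sig w n m) eqn:E'; [right; auto|congruence].
  - exists []. intros z D. apply N. apply (proj1 (full_differ _ _ _ _)) in D.
    destruct D as (v & w & m & -> & -> & _). split; apply full_isV; eauto.
Qed.

(** The decoding ignores entries before the marker, so [v] is kept below [n], the marker is put at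
    [n], and [g] is written from [S n] on. *)
Lemma full_dense n (v : fvec) g : exists w : fvec,
  fcol w = g /\ forall k m, k < n -> proj1_sig v k m = proj1_sig w k m.
Proof.
  set (w := fun k m => if lt_dec k n then proj1_sig v k m else
    if Nat.eq_dec k n then false else
    if excluded_middle_informative (m = g (k - S n)) then true else false).
  assert (Hw : locally_finite w).
  { intros k. destruct (proj2_sig v k) as [l Hl]. exists (g (k - S n) :: l).
    intros m. unfold w. destruct (lt_dec k n); [right; auto|].
    destruct (Nat.eq_dec k n); [discriminate|].
    destruct (excluded_middle_informative (m = g (k - S n))); [left; auto|discriminate]. }
  exists (exist _ w Hw). split.
  - apply fcol_decodes. exists n. simpl. split.
    + intros m. unfold w. destruct (lt_dec n n); [lia|].
      destruct (Nat.eq_dec n n); [reflexivity|lia].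
    + intros k m. unfold w. destruct (lt_dec (S (n + k)) n); [lia|].
      destruct (Nat.eq_dec (S (n + k)) n); [lia|].
      replace (S (n + k) - S n) with k by lia.
      destruct (excluded_middle_informative (m = g k)); split; congruence.
  - intros k m Hk. simpl. unfold w. destruct (lt_dec k n); [reflexivity|lia].
Qed.

Lemma full_flip n (v : fvec) m : exists w : fvec,
  (forall k m', k < n -> proj1_sig v k m' = proj1_sig w k m') /\
  forall m', proj1_sig v n m' <> proj1_sig w n m' <-> m' = m.
Proof.
  set (w := fun k m' => if excluded_middle_informative (k = n /\ m' = m)
    then negb (proj1_sig v k m') else proj1_sig v k m').
  assert (Hw : locally_finite w).
  { intros k. destruct (proj2_sig v k) as [l Hl]. exists (m :: l). intros m'. unfold w.
    destruct (excluded_middle_informative (k = n /\ m' = m)) as [[_ ->]|_];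
      [left; reflexivity|right; auto]. }
  exists (exist _ w Hw). simpl. unfold w. split.
  - intros k m' Hk. destruct (excluded_middle_informative (k = n /\ m' = m)); [lia|reflexivity].
  - intros m'. destruct (excluded_middle_informative (n = n /\ m' = m)) as [[_ E]|N].
    + split; [auto|]. intros _. destruct (proj1_sig v n m'); discriminate.
    + split; [congruence|]. intros ->. tauto.
Qed.

Lemma full_model_tree (sigma : formula L) :
  models X sigma -> infinite_type (dom X) -> sentence L sigma ->
  tree_model sigma full_model.
Proof.
  intros HX [i Hi] B. destruct (dom_inhabited _ X) as [d]. constructor.
  - intros x [z ->] P. apply (proj1 (full_isP _)) in P. destruct P. discriminate.
  - intros r xs [zs [-> _]] j. exists (zs j). reflexivity.
  - intros f xs U. destruct (choice _ U) as [zs Hzs].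
    rewrite (proj1 (full_fun f xs) zs); [eexists; reflexivity|].
    apply functional_extensionality, Hzs.
  - intros f j xs Hj Nj. apply (proj2 (full_fun f xs) j); assumption.
  - exists (inl d), d. reflexivity.
  (* [tr sigma] is a sentence, so the environment may be replaced by one with values in [RU], where
     [sat_tr] applies. *)
  - intros e. apply (sat_sentence full_model (tr sigma) (fun n => inl d) e).
    { apply tr_fbound, B. }
    apply (sat_tr X full_model inl) with (e := fun n => d).
    + intros x y E. injection E. auto.
    + intros y. split; intros [z E]; exists z; auto.
    + intros f xs. symmetry. apply (proj1 (full_fun f (fun k => inl (xs k)))). reflexivity.
    + intros r xs. split.
      * intros R. exists xs. auto.
      * intros [zs [E R]]. replace xs with zs; [exact R|].
        apply functional_extensionality. intros k.
        assert (E' := f_equal (fun h => h k) E). simpl in E'. congruence.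
    + apply HX.
  - intros x y C. apply (proj1 (full_colour _ _)) in C. destruct C as (v & -> & ->).
    split; [apply full_isV|apply full_isP]; eauto.
  - intros x V. apply full_isV in V. destruct V as [v ->].
    exists (inr (inr (fcol v))). apply full_colour. eauto.
  - intros x y z C C'. apply (proj1 (full_colour _ _)) in C, C'.
    destruct C as (v & -> & ->), C' as (v' & E & ->). injection E as <-. reflexivity.
  - intros n x y z D. apply (proj1 (full_differ _ _ _ _)) in D.
    destruct D as (v & w & m & -> & -> & -> & A & _).
    repeat split; try (apply full_isV; eauto); [exists m; reflexivity|].
    apply full_agree. exact A.
  - intros n x y z t Vx Vy Vz A A'. apply full_isV in Vx, Vy, Vz.
    destruct Vx as [v ->], Vy as [w ->], Vz as [u ->].
    destruct (classic (in_U t)) as [[m ->]|N].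
    + rewrite !full_differ_vec. assert (H := proj1 (full_agree _ _ _) A).
      assert (H' := proj1 (full_agree _ _ _) A').
      assert (H'' : forall k m', k < n -> proj1_sig v k m' = proj1_sig u k m').
      { intros k m' Hk. rewrite H by exact Hk. apply H', Hk. }
      clear - H H' H''.
      destruct (proj1_sig v n m), (proj1_sig w n m), (proj1_sig u n m); intuition congruence.
    + assert (K : forall a b, ~ differ full_model n a b t).
      { intros a b D. apply N. apply (proj1 (full_differ _ _ _ _)) in D.
        destruct D as (? & ? & m & _ & _ & -> & _). exists m. reflexivity. }
      assert (K1 := K (inr (inl v)) (inr (inl u))).
      assert (K2 := K (inr (inl v)) (inr (inl w))).
      assert (K3 := K (inr (inl w)) (inr (inl u))). tauto.
  - intros n x y. destruct (full_differ_list n x y) as [l Hl].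
    exists (length l), (fun j => nth (proj1_sig j) l (inl d)). intros z D.
    destruct (In_nth l z (inl d) (Hl z D)) as (k & Hk & E).
    exists (exist _ k Hk). auto.
  - intros n x y Vx Uy. apply full_isV in Vx. destruct Vx as [v ->]. destruct Uy as [m ->].
    destruct (full_flip n v m) as (w & A & D). exists (inr (inl w)).
    split; [apply full_isV; eauto|]. split; [apply full_agree, A|].
    intros z. split.
    + intros D'. apply (proj1 (full_differ _ _ _ _)) in D'.
      destruct D' as (v' & w' & m' & E1 & E2 & -> & _ & Ne).
      injection E1 as <-. injection E2 as <-. f_equal. apply D, Ne.
    + intros ->. apply full_differ_vec. split; [exact A|]. apply D. reflexivity.
  - intros n x y Vx Py. apply full_isV in Vx. apply (proj1 (full_isP _)) in Py.
    destruct Vx as [v ->], Py as [g ->]. destruct (full_dense n v g) as (w & C & A).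
    exists (inr (inl w)). split; [|apply full_agree, A].
    apply full_colour. exists w. rewrite C. auto.
  - intros x y Vx Vy N. apply full_isV in Vx, Vy. destruct Vx as [v ->], Vy as [w ->].
    do 2 f_equal. apply sig_eq. apply functional_extensionality. intros k.
    apply functional_extensionality. intros m.
    assert (A : agree full_model (S k) (inr (inl v)) (inr (inl w))) by (intros j _; apply N).
    apply (proj1 (full_agree _ _ _) A). lia.
  - assert (Z : locally_finite (fun _ _ => false)) by (intros n; exists []; discriminate).
    exists (inr (inl (exist _ _ Z))). apply full_isV. eauto.
  - intros N xs. destruct (arg_list _ _ xs) as [l [Hl _]].
    destruct (fresh_value fdom (fun n => inr (inr (fun _ => i n))) l) as [n Hn].
    { intros a b E. injection E as E. apply Hi. exact (f_equal (fun g => g 0) E). }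
    exists (inr (inr (fun _ => i n))). split; [apply full_isP; eauto|].
    intros j E. apply Hn. rewrite E. apply Hl.
Qed.

Lemma full_model_P_card (K : Type) :
  card_eq (dom X) K -> card_eq {x | isP full_model x} (nat -> K).
Proof.
  intros [f [g [gf fg]]].
  assert (Ex : forall x : {x | isP full_model x}, exists h, proj1_sig x = inr (inr h)).
  { intros [x P]. apply full_isP, P. }
  destruct (choice _ Ex) as [h Hh].
  exists (fun x n => f (h x n)). apply bijective_of_inj_surj.
  - intros x y E. apply sig_eq. rewrite Hh, (Hh y). do 2 f_equal.
    apply functional_extensionality. intros n.
    rewrite <- (gf (h x n)), <- (gf (h y n)). f_equal. exact (f_equal (fun k => k n) E).
  - intros k.
    assert (P : isP full_model (inr (inr (fun n => g (k n))))) by (apply full_isP; eauto).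
    exists (exist _ _ P). apply functional_extensionality. intros n.
    assert (E := Hh (exist _ _ P)). simpl in E. injection E as E. rewrite <- E. apply fg.
Qed.

End FullModel.

(** * Completeness from countable categoricity *)

Definition And {L} (p q : formula L) : formula L :=
  BigAnd (fun n => match n with 0 => p | _ => q end).

(* A sentence and its negation, both consistent with [phi], would hold in countable
   models of [phi]. *)
Lemma complete_of_countable_categoricity {L} (phi : formula L) :
  sentence L phi ->
  (forall M N : structure L, models M phi -> models N phi ->
    countable_type (dom M) -> countable_type (dom N) -> exists h, isomorphism M N h) ->
  complete_sentence phi.
Proof.
  intros B H. split; [exact B|]. intros tau T.
  apply NNPP. intros N. apply not_or_and in N. destruct N as [N1 N2].
  assert (W : forall psi, sentence L psi -> ~ valid (Impl L phi psi) ->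
    exists M : structure L, models M phi /\ ~ models M psi /\ countable_type (dom M)).
  { intros psi P N.
    assert (E : exists (M : structure L) e, sat M e phi /\ ~ sat M e psi).
    { apply NNPP. intros N'. apply N. intros M e. apply sat_Impl. intros S.
      apply NNPP. intros S'. apply N'. eauto. }
    destruct E as (M & e & S & S').
    (* Löwenheim-Skolem preserves a single sentence, so both requirements are put into one
       conjunction. *)
    assert (BA : sentence L (And phi (Neg psi))) by (intros [|n]; assumption).
    destruct (countable_model M (And phi (Neg psi)) BA) as (C & HC & CC).
    - apply (models_of_sat M _ e BA). intros [|n]; assumption.
    - exists C. split; [intros e'; exact (HC e' 0)|]. split; [|exact CC].
      intros HP. destruct (dom_inhabited _ C) as [d].
      exact (HC (fun _ => d) 1 (HP _)). }
  destruct (W tau T N1) as (M & HM & M1 & CM).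
  destruct (W (Neg tau) T N2) as (M' & HM' & M2 & CM').
  destruct (H M M' HM HM' CM CM') as [h Hh].
  apply M2. intros e' S. apply M1. intros e. apply (sat_isomorphism M M' h Hh).
  exact (sat_sentence M' tau _ _ T S).
Qed.

(** lambda^{aleph_0} is represented by the function type nat -> K where |K| = lambda *)
Theorem theorem3p4 (K : Type) :
  infinite_type K ->
  completely_characterizable K ->
  homogeneously_characterizable (nat -> K).
Proof.
  intros HK [_ (L & sigma & C & Hmod & Hsucc)].
  assert (B : sentence L sigma) by apply C.
  destruct (tree_model_definable sigma B) as (phi & Bphi & Hphi).
  destruct (Hmod K HK (card_le_refl K)) as (X & HX & EX).
  assert (IX : infinite_type (dom X)).
  { eapply infinite_of_card_le; [exact HK|]. apply card_eq_le, card_eq_sym, EX. }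
  assert (HF : models (full_model X) phi) by (apply Hphi, full_model_tree; assumption).
  split.
  { eapply infinite_of_card_le; [exact HK|].
    exists (fun k _ => k). intros x y E. exact (f_equal (fun g => g 0) E). }
  exists (tree_lang L), phi, (inr RP : rsym (tree_lang L)).
  split; [reflexivity|]. split; [|split; [|split; [|split]]].
  - apply complete_of_countable_categoricity; [exact Bphi|].
    intros M N HM HN. apply (countable_tree_models_isomorphic M N C); apply Hphi; assumption.
  (* The [RU] part of [M] is a model of [sigma], hence bounded by [K], and this bounds all of [M] by
     [nat -> K]. *)
  - intros (M & HM & _ & N). apply N. apply Hphi in HM.
    apply (tree_model_card sigma M K HK HM).
    apply (no_model_above K sigma HK B Hsucc (U_part HM)), U_part_models.
  - apply (countable_model (full_model X)); assumption.
  - intros M HM. apply (tree_model_homogeneous (sigma := sigma)), Hphi, HM.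
  - exists (full_model X). split; [exact HF|]. apply full_model_P_card, EX.
Qed.
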